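(* Consider the binary affiliation random graph model described in the context, with $\alpha\ne\beta$, and suppose that the group proportions $\boldsymbol\pi=(\pi_1,\ldots,\pi_Q)$ are known. Let $s_2=\sum_q\pi_q^2$, $s_3=\sum_q\pi_q^3$, and let $\hat m_1,\hat m_2,\hat m_3$ be the empirical moments defined in the context. (i) If the $\pi_q$'s are unequal (not all equal to $1/Q$), let $$\hat\beta=\frac{(s_3-s_2s_3)\hat m_1^3+(s_2^3-s_3)\hat m_2\hat m_1+(s_3s_2-s_2^3)\hat m_3}{(\hat m_1^2-\hat m_2)(2s_2^3-3s_3s_2+s_3)},\qquad \hat\alpha=\frac{\hat m_1+(s_2-1)\hat\beta}{s_2}.$$ Then $(\hat\alpha,\hat\beta)\to(\alpha,\beta)$ almost surely as $n\to\infty$, and the rate of this convergence is at least $1/\sqrt n$. (ii) If the $\pi_q$'s are all equal (to $1/Q$), let $$\hat\beta=\hat m_1+\Big(\frac{\hat m_1^3-\hat m_3}{Q-1}\Big)^{1/3},\qquad \hat\alpha=Q\hat m_1+(1-Q)\hat\beta.$$ Then $(\hat\alpha,\hat\beta)\to(\alpha,\beta)$ almost surely as $n\to\infty$, and the rate of this convergence is at least $1/n$.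
   Context: Binary affiliation model. Fix $Q\ge2$ and $\boldsymbol\pi\in(0,1)^Q$ with $\sum_q\pi_q=1$, and $\alpha,\beta\in(0,1)$ with $\alpha\neq\beta$. The latent variables $Z_i=(Z_{i1},\ldots,Z_{iQ})\in\{0,1\}^Q$, $i\ge1$, are i.i.d. with multinomial distribution $\mathcal M(1,\boldsymbol\pi)$ (exactly one coordinate equals $1$, and $\mathbb P(Z_{iq}=1)=\pi_q$). Conditionally on the $Z_i$'s, the edge indicators $\{X_{ij}\}_{i<j}$ are independent Bernoulli variables, with parameter $\alpha$ if $Z_i=Z_j$ and $\beta$ if $Z_i\ne Z_j$. The graph is undirected: $X_{ji}=X_{ij}$. Only the $X_{ij}$, $1\le i<j\le n$, are observed; $n$ is the number of nodes. Empirical moments, where sums run over tuples of pairwise distinct indices in $\{1,\ldots,n\}$: $$\hat m_1=\frac{1}{n(n-1)}\sum_{(i,j)}X_{ij},\quad \hat m_2=\frac{1}{n(n-1)(n-2)}\sum_{(i,j,k)}X_{ij}X_{ik},\quad \hat m_3=\frac{1}{n(n-1)(n-2)}\sum_{(i,j,k)}X_{ij}X_{ik}X_{jk}.$$ Conventions. $x^{1/3}$ is the real cube root. The estimators in (i) are defined by the displayed formula when the denominator is non-zero and arbitrarily otherwise. ''The rate of convergence of $\hat\theta_n$ to $\theta$ is at least $r_n$'' means that $r_n^{-1}(\hat\theta_n-\theta)$ is bounded in probability. *)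

(* Defs.v *)
From HB Require Import structures.
From mathcomp Require Import all_boot all_order all_algebra.
From mathcomp Require Import all_classical all_reals all_analysis.

Set Implicit Arguments.
Unset Strict Implicit.
Unset Printing Implicit Defensive.

Import Order.TTheory GRing.Theory Num.Theory.
Import numFieldNormedType.Exports.

Local Open Scope classical_set_scope.
Local Open Scope ring_scope.

Section Independence.
Context (d : measure_display) (T : measurableType d) (R : realType).
Variable P : probability T R.

Definition sigma_rv d' (T' : measurableType d') (Y : T -> T') : set (set T) :=
  preimage_set_system setT Y measurable.

Definition sigma_family d' (T' : measurableType d') (Y : nat -> T -> T') :
    set (set T) :=
  <<s \bigcup_i sigma_rv (Y i) >>.

Definition independent (I : choiceType) (F : I -> set (set T)) : Prop :=
  forall (s : seq I) (E : I -> set T), uniq s ->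
    (forall i, i \in s -> F i (E i)) ->
    P (\bigcap_(i in [set` s]) E i) = (\prod_(i <- s) P (E i))%E.

(* f is a version of the conditional probability of E given the
   sub-sigma-algebra G. *)
Definition is_cond_prob (G : set (set T)) (E : set T) (f : T -> R) : Prop :=
  [/\ forall B : set R, measurable B -> G (f @^-1` B),
      P.-integrable setT (EFin \o f) &
      forall A, G A -> (\int[P]_(w in A) (f w)%:E)%E = P (A `&` E)].

(* Conditional independence given G of the set systems F i, i in D. The choice
   of the versions f i is immaterial, two versions being a.s. equal. *)
Definition cond_independent (G : set (set T)) (I : choiceType) (D : set I)
    (F : I -> set (set T)) : Prop :=
  forall (s : seq I) (E : I -> set T) (f : I -> T -> R), uniq s ->
    (forall i, i \in s -> [/\ D i, F i (E i) & is_cond_prob G (E i) (f i)]) ->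
    is_cond_prob G (\bigcap_(i in [set` s]) E i)
      (fun w => \prod_(i <- s) f i w).

Definition bounded_in_probability (V : normedModType R) (Y : nat -> T -> V) :
    Prop :=
  forall eps : R, 0 < eps ->
    exists M : R, forall n, (P [set w | (M < `|Y n w|)%R] <= eps%:E)%E.

Definition convergence_rate_at_least (V : normedModType R)
    (est : nat -> T -> V) (theta : V) (r : nat -> R) : Prop :=
  bounded_in_probability (fun n w => (r n)^-1 *: (est n w - theta)).

End Independence.

Section AffiliationModel.
Context (d : measure_display) (T : measurableType d) (R : realType).
Variable P : probability T R.

(* Nodes are numbered from 0; the graph on n nodes has node set {0, ..., n-1}.
   The diagonal entries X i i are unconstrained and never used. *)
Definition binary_affiliation_model (Q : nat) (p : 'I_Q -> R)
    (alpha beta : R) (Z : nat -> {RV P >-> Q.-tuple bool})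
    (X : nat -> nat -> {RV P >-> bool}) : Prop :=
  [/\ [/\ forall i, {ae P, forall w, (\sum_(q < Q) tnth (Z i w) q = 1)%N},
          forall i q, P [set w | tnth (Z i w) q] = (p q)%:E &
          independent P (fun i => sigma_rv (Z i))],
      forall i j, (i < j)%N -> forall b : bool,
        is_cond_prob P (sigma_family (fun k => (Z k : T -> Q.-tuple bool)))
          [set w | X i j w = b]
          (fun w => bernoulli_pmf (if Z i w == Z j w then alpha else beta) b),
      cond_independent P (sigma_family (fun k => (Z k : T -> Q.-tuple bool)))
        [set e : nat * nat | (e.1 < e.2)%N]
        (fun e => sigma_rv (X e.1 e.2)) &
      forall i j, i != j -> forall w, X j i w = X i j w].

Variable X : nat -> nat -> {RV P >-> bool}.

Definition edge (i j : nat) (w : T) : R := (X i j w)%:R.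

Definition emp_m1 (n : nat) (w : T) : R :=
  (n%:R * (n%:R - 1))^-1 *
  \sum_(i < n) \sum_(j < n | uniq [:: i; j]) edge i j w.

Definition emp_m2 (n : nat) (w : T) : R :=
  (n%:R * (n%:R - 1) * (n%:R - 2))^-1 *
  \sum_(i < n) \sum_(j < n) \sum_(k < n | uniq [:: i; j; k])
    edge i j w * edge i k w.

Definition emp_m3 (n : nat) (w : T) : R :=
  (n%:R * (n%:R - 1) * (n%:R - 2))^-1 *
  \sum_(i < n) \sum_(j < n) \sum_(k < n | uniq [:: i; j; k])
    edge i j w * edge i k w * edge j k w.

End AffiliationModel.

(* powR is only meaningful on nonnegative bases, hence the sign. *)
Definition cbrt (R : realType) (x : R) : R := Num.sg x * (`|x| `^ 3^-1).

(* Main.v *)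
(** The edge indicators being conditionally independent given the labels, the
mean of a product over distinct edges is the average of the corresponding product
of connectivities over independent labels.  Writing [delta = alpha - beta], the
three empirical moments thus have means
  [mu1 = beta + s2 delta],  [mu2 = beta^2 + 2 s2 beta delta + s3 delta^2],
  [mu3 = beta^3 + 3 s2 beta^2 delta + 3 s3 beta delta^2 + s3 delta^3],
from which the two formulas recover [beta].  Each moment is an average over ordered
triples of nodes; triples without a common node are uncorrelated, hence a variance
[O(1/n)].  When the proportions are equal, conditioning a single-edge or triangle
indicator on one label does not change its mean, triples with one common node are
uncorrelated too, and the variance is [O(1/n^2)].  Chebyshev's inequality gives the
rates through local Lipschitz bounds on the estimators.  Almost sure convergence
follows from Borel-Cantelli along the squares, the moments varying by [O(1/k)] between
[k^2] and [(k+1)^2]. *)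

Require Import Defs.
From HB Require Import structures.
From mathcomp Require Import all_boot all_order all_algebra.
From mathcomp Require Import all_classical all_reals all_analysis.
From mathcomp Require Import measurable_realfun.
From mathcomp Require Import ring lra zify.

Set Implicit Arguments.
Unset Strict Implicit.
Unset Printing Implicit Defensive.

Import Order.TTheory GRing.Theory Num.Theory.
Import numFieldNormedType.Exports.

Local Open Scope classical_set_scope.
Local Open Scope ring_scope.

(** * Bounded measurable functions *)

(** The split into two cases comes from [mu1^2 - mu2 = delta^2 (s2^2 - s3)], which vanishes exactly
    when the proportions are equal. Then [mu2 = mu1^2] brings nothing new, and [beta] is read from
    [mu1^3 - mu3 = - (Q - 1) (delta / Q)^3] instead. The cube root is not Lipschitz at zero, but it
    is taken near [- delta / Q], nonzero since [alpha] differs from [beta]. All three moments are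
    instances of one [triple_stat]: a single edge is a motif on three nodes whose third node is
    idle, so one second-moment computation serves them all. Boundedness in probability asks for one
    bound valid for every [n], whereas the estimates hold only from some rank on. The finitely many
    remaining [n] are handled by tightness of a single real variable, which is why measurability of
    the estimators is carried along. *)

Section BoundedMeasurable.
Context (d : measure_display) (T : measurableType d) (R : realType).
Context (P : probability T R).

(** The class in which expectations are computed: it is closed under sums and products and contained
    in the integrable functions, so [Rintegral] is linear on it. *)
Definition bounded_measurable (f : T -> R) : Prop :=
  measurable_fun setT f /\ exists M, forall w, `|f w| <= M.

Local Notation "''E' f" := (Rintegral P setT f) (at level 10, f at level 8).

Lemma bounded_measurable_integrable f :
  bounded_measurable f -> P.-integrable setT (EFin \o f).
Proof.
move=> [mf [M hM]]; apply: measurable_bounded_integrable => //.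
  by rewrite (le_lt_trans (probability_le1 P measurableT)) ?ltry.
exists M; split; first exact: num_real.
by move=> x Mx w _ /=; exact: le_trans (hM w) (ltW Mx).
Qed.

Lemma bounded_measurable_cst (r : R) : bounded_measurable (fun=> r).
Proof. by split; [exact: measurable_cst | exists `|r|]. Qed.

Lemma bounded_measurableD f g : bounded_measurable f -> bounded_measurable g ->
  bounded_measurable (fun w => f w + g w).
Proof.
move=> [mf [M hM]] [mg [N hN]]; split; first exact: measurable_funD.
by exists (M + N) => w; exact: le_trans (ler_normD _ _) (lerD (hM w) (hN w)).
Qed.

Lemma bounded_measurableM f g : bounded_measurable f -> bounded_measurable g ->
  bounded_measurable (fun w => f w * g w).
Proof.
move=> [mf [M hM]] [mg [N hN]]; split; first exact: measurable_funM.
by exists (M * N) => w; rewrite normrM ler_pM.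
Qed.

Lemma bounded_measurableB f g : bounded_measurable f -> bounded_measurable g ->
  bounded_measurable (fun w => f w - g w).
Proof.
move=> [mf [M hM]] [mg [N hN]]; split; first exact: measurable_funB.
by exists (M + N) => w; exact: le_trans (ler_normB _ _) (lerD (hM w) (hN w)).
Qed.

Lemma bounded_measurableX f n :
  bounded_measurable f -> bounded_measurable (fun w => f w ^+ n).
Proof.
move=> hf; elim: n => [|n IHn]; first exact: bounded_measurable_cst.
by under eq_fun do rewrite exprS; exact: bounded_measurableM.
Qed.

Lemma bounded_measurable_norm f :
  bounded_measurable f -> bounded_measurable (fun w => `|f w|).
Proof.
move=> [mf [M hM]]; split; first exact: measurableT_comp.
by exists M => w; rewrite normr_id.
Qed.

Lemma bounded_measurable_sum (I : Type) (s : seq I) (p : pred I)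
    (F : I -> T -> R) : (forall i, p i -> bounded_measurable (F i)) ->
  bounded_measurable (fun w => \sum_(i <- s | p i) F i w).
Proof.
move=> hF; elim: s => [|i s IHs].
  by under eq_fun do rewrite big_nil; exact: bounded_measurable_cst.
under eq_fun do rewrite big_cons; case pi: (p i) => //.
exact: bounded_measurableD (hF _ pi) IHs.
Qed.

Lemma bounded_measurable_prod (I : Type) (s : seq I) (F : I -> T -> R) :
  (forall i, bounded_measurable (F i)) ->
  bounded_measurable (fun w => \prod_(i <- s) F i w).
Proof.
move=> hF; elim: s => [|i s IHs].
  by under eq_fun do rewrite big_nil; exact: bounded_measurable_cst.
by under eq_fun do rewrite big_cons; exact: bounded_measurableM.
Qed.

Lemma bounded_measurable_nat (b : T -> bool) :
  measurable [set w | b w] -> bounded_measurable (fun w => (b w)%:R).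
Proof.
move=> mb; split; last first.
  by exists 1 => w; case: (b w); rewrite ?normr0 ?normr1.
rewrite (_ : (fun w => _) = \1_[set w | b w]); first exact: measurable_indic.
by apply/funext => w; rewrite indicE mem_setE.
Qed.

Lemma expect_cst (r : R) : 'E (fun=> r) = r.
Proof.
rewrite Rintegral_cst // [X in r * X](_ : _ = 1) ?mulr1 //.
exact: (congr1 fine (@probability_setT _ _ _ P)).
Qed.

Lemma expectD f g : bounded_measurable f -> bounded_measurable g ->
  'E (fun w => f w + g w) = 'E f + 'E g.
Proof. by move=> hf hg; rewrite RintegralD //; exact: bounded_measurable_integrable. Qed.

Lemma expectB f g : bounded_measurable f -> bounded_measurable g ->
  'E (fun w => f w - g w) = 'E f - 'E g.
Proof. by move=> hf hg; rewrite RintegralB //; exact: bounded_measurable_integrable. Qed.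

Lemma expectZ (r : R) f : bounded_measurable f ->
  'E (fun w => r * f w) = r * 'E f.
Proof. by move=> hf; rewrite RintegralZl //; exact: bounded_measurable_integrable. Qed.

Lemma expect_sum (I : Type) (s : seq I) (p : pred I) (F : I -> T -> R) :
  (forall i, p i -> bounded_measurable (F i)) ->
  'E (fun w => \sum_(i <- s | p i) F i w) = \sum_(i <- s | p i) 'E (F i).
Proof.
move=> hF; elim: s => [|i s IHs].
  by under eq_fun do rewrite big_nil; rewrite big_nil expect_cst.
under eq_fun do rewrite big_cons; rewrite big_cons; case pi: (p i) => //.
by rewrite expectD ?IHs //; [exact: hF | exact: bounded_measurable_sum].
Qed.

Lemma le_expect f g : bounded_measurable f -> bounded_measurable g ->
  (forall w, f w <= g w) -> 'E f <= 'E g.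
Proof.
by move=> hf hg fg; apply: le_Rintegral => //; exact: bounded_measurable_integrable.
Qed.

Lemma expect_nat (b : T -> bool) : measurable [set w | b w] ->
  'E (fun w => (b w)%:R) = fine (P [set w | b w]).
Proof.
move=> mb; rewrite /Rintegral; congr fine.
rewrite -[X in P X]setIT -integral_indic //.
by apply: eq_integral => w _; rewrite indicE mem_setE.
Qed.

(** Serves to replace label vectors by labels, the vectors being one-hot only almost surely. *)
Lemma eq_expect_ae f g : bounded_measurable f -> bounded_measurable g ->
  {ae P, forall w, f w = g w} -> 'E f = 'E g.
Proof.
move=> [mf _] [mg _] fg; rewrite /Rintegral; congr fine.
apply: ae_eq_integral => //; try exact/measurable_EFinP.
by apply: filterS fg => w /= -> _.
Qed.

Lemma chebyshev_tail f (e : R) : bounded_measurable f -> 0 < e ->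
  (P [set w | (e < `|f w|)%R] <= ('E (fun w => f w ^+ 2) / e ^+ 2)%:E)%E.
Proof.
move=> hf e0.
have mA : measurable [set w | e < `|f w|].
  rewrite -[X in measurable X]setTI.
  have : measurable_fun setT (fun w => `|f w|) by case: (bounded_measurable_norm hf).
  by move=> /(_ measurableT `]e, +oo[%classic); rewrite preimage_itvoy; exact.
rewrite -[P _]fineK ?fin_num_measure // lee_fin -expect_nat // ler_pdivlMr ?exprn_gt0 //.
rewrite mulrC -expectZ; last exact: bounded_measurable_nat.
apply: le_expect => [||w].
- apply: bounded_measurableM; first exact: bounded_measurable_cst.
  exact: bounded_measurable_nat.
- exact: bounded_measurableX.
- case: ltP => [ef|_]; last by rewrite mulr0 sqr_ge0.
  by rewrite mulr1 -(real_normK (num_real (f w))) lerXn2r ?nnegrE // ltW.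
Qed.

End BoundedMeasurable.

(** * Averages over the labels *)

Section LabelAverage.
Context (R : realType) (Q : nat) (p : 'I_Q -> R).

Definition relabel (z : nat -> 'I_Q) (a : nat) (q : 'I_Q) : nat -> 'I_Q :=
  fun i => if i == a then q else z i.

(** Mean of [g] when the labels of the nodes in [u] are redrawn independently from [p] and the
    others stay frozen at [z]. Nested sums allow nodes to be integrated out one at a time. *)
Fixpoint label_avg (u : seq nat) (g : (nat -> 'I_Q) -> R) (z : nat -> 'I_Q) : R :=
  if u is a :: u' then \sum_(q < Q) p q * label_avg u' g (relabel z a q) else g z.

Definition supported (u : seq nat) (g : (nat -> 'I_Q) -> R) : Prop :=
  forall z z', {in u, z =1 z'} -> g z = g z'.

Lemma label_avg_cat u v g z :
  label_avg (u ++ v) g z = label_avg u (label_avg v g) z.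
Proof. by elim: u z => //= a u IHu z; apply: eq_bigr => q _; rewrite IHu. Qed.

Lemma eq_label_avg u g h z : g =1 h -> label_avg u g z = label_avg u h z.
Proof. by move=> gh; elim: u z => [|a u IHu] z //=; apply: eq_bigr => q _; rewrite IHu. Qed.

Lemma label_avgMl t v f g z : supported t f -> ~~ has (mem t) v ->
  label_avg v (fun y => f y * g y) z = f z * label_avg v g z.
Proof.
move=> ft; elim: v z => //= a v IHv z; rewrite negb_or => /andP[at_ vt].
rewrite big_distrr /=; apply: eq_bigr => q _; rewrite IHv // mulrCA.
congr (_ * (_ * _)); apply: ft => i it; rewrite /relabel.
by case: eqP at_ => // <-; rewrite it.
Qed.

Lemma label_avgMr u g (r : R) z :
  label_avg u (fun y => g y * r) z = label_avg u g z * r.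
Proof.
elim: u z => //= a u IHu z; rewrite big_distrl /=.
by apply: eq_bigr => q _; rewrite IHu mulrA.
Qed.

(** Independence in terms of labels. The function [g] may still depend on labels in [t], provided
    that averaging over [v] alone already makes it constant; this covers disjoint motifs and
    degenerate motifs sharing a node. *)
Lemma label_avg_prod t v f g (r : R) z : supported t f -> ~~ has (mem t) v ->
  (forall y, label_avg v g y = r) ->
  label_avg (t ++ v) (fun y => f y * g y) z = label_avg t f z * r.
Proof.
move=> ft vt hr; rewrite label_avg_cat -label_avgMr; apply: eq_label_avg => y.
by rewrite (label_avgMl _ _ ft) // hr.
Qed.

Lemma supportedW u v g : {subset u <= v} -> supported u g -> supported v g.
Proof. by move=> uv gu z z' zz'; apply: gu => i /uv; exact: zz'. Qed.

End LabelAverage.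

Section LabelExpectation.
Context (d : measure_display) (T : measurableType d) (R : realType).
Context (P : probability T R) (Q : nat) (p : 'I_Q -> R) (C : nat -> T -> 'I_Q).

Local Notation "''E' f" := (Rintegral P setT f) (at level 10, f at level 8).

Hypothesis mC : forall i q, measurable [set w | C i w == q].
Hypothesis lawC : forall (s : seq nat) z, uniq s ->
  'E (fun w => (all (fun i => C i w == z i) s)%:R) = \prod_(i <- s) p (z i).

Lemma measurable_all_labels s z :
  measurable [set w | all (fun i => C i w == z i) s].
Proof.
elim: s => [|i s IHs] /=; first by rewrite (_ : [set _ | _] = setT) //; apply/seteqP.
rewrite (_ : [set _ | _] = [set w | C i w == z i] `&`
    [set w | all (fun i => C i w == z i) s]); first exact: measurableI.
by apply/seteqP; split => w /= /andP.
Qed.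

(* The indicator freezes the labels of [v], and those of [u] are integrated out one
   node at a time. *)
Lemma expect_labels_given u v g z : uniq (u ++ v) -> supported (u ++ v) g ->
  bounded_measurable (fun w => g (C^~ w)) ->
  'E (fun w => (all (fun i => C i w == z i) v)%:R * g (C^~ w)) =
  (\prod_(i <- v) p (z i)) * label_avg p u g z.
Proof.
elim: u v z => [|a u IHu] v z uv gs mg /=.
  rewrite -(lawC _ uv) mulrC -expectZ; last first.
    exact: bounded_measurable_nat (measurable_all_labels _ _).
  apply: eq_Rintegral => w _.
  case: (boolP (all (fun i => C i w == z i) v)) => [/allP Cz|_]; last by rewrite mul0r mulr0.
  by rewrite mul1r mulr1; apply: gs => i iv; exact/eqP/Cz.
have av : a \notin v by move: uv => /=; rewrite mem_cat negb_or => /andP[/andP[]].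
have step q w : all (fun i => C i w == relabel z a q i) (a :: v) =
    (C a w == q) && all (fun i => C i w == z i) v.
  rewrite /= {1}/relabel eqxx; congr (_ && _); apply: eq_in_all => i iv.
  by rewrite /relabel; case: (i =P a) => // ia; rewrite -ia iv in av.
rewrite (_ : (fun w => _) = fun w => \sum_(q < Q)
    (all (fun i => C i w == relabel z a q i) (a :: v))%:R * g (C^~ w)); last first.
  apply/funext => w; rewrite (bigD1 (C a w)) //= -/(all _ (a :: v)) step eqxx /=.
  rewrite big1 ?addr0 // => q qC; rewrite -/(all _ (a :: v)) step.
  by rewrite eq_sym (negbTE qC) mul0r.
rewrite expect_sum; last first.
  move=> q _; apply: bounded_measurableM => //.
  exact: bounded_measurable_nat (measurable_all_labels _ _).
rewrite big_distrr /=; apply: eq_bigr => q _.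
rewrite [LHS](IHu (a :: v) (relabel z a q)) //.
- rewrite big_cons {1}/relabel eqxx mulrCA mulrA; congr (_ * _ * _).
  rewrite big_seq [RHS]big_seq; apply: eq_bigr => i iv.
  by rewrite /relabel; case: (i =P a) => // ia; rewrite -ia iv in av.
- by rewrite -[a :: v]cat1s uniq_catCA.
- apply: supportedW gs => i.
  by rewrite -[a :: v]cat1s !mem_cat !inE -orbA orbCA.
Qed.

Lemma expect_labels u g z : uniq u -> supported u g ->
  bounded_measurable (fun w => g (C^~ w)) ->
  'E (fun w => g (C^~ w)) = label_avg p u g z.
Proof.
move=> uu gs mg; have := @expect_labels_given u [::] g z.
rewrite cats0 => /(_ uu gs mg); rewrite big_nil mul1r => <-.
by apply: eq_Rintegral => w _; rewrite /= mul1r.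
Qed.

End LabelExpectation.

(** * Products of edge indicators *)

Section OneHot.
Context (Q : nat) (q0 : 'I_Q).

Definition one_hot (t : Q.-tuple bool) : bool := (\sum_(q < Q) tnth t q == 1)%N.

(* Vectors without a true coordinate get the junk label [q0]. *)
Definition label_of (t : Q.-tuple bool) : 'I_Q := odflt q0 [pick q | tnth t q].

Lemma one_hotP t q : one_hot t -> tnth t q = (q == label_of t).
Proof.
rewrite /one_hot /label_of => t1; case: pickP => [r tr|t0] /=; last first.
  by move: t1; rewrite big1 // => r _; rewrite t0.
have [->|qr] := eqVneq q r; first by rewrite tr.
move: t1; rewrite (bigD1 r) //= (bigD1 q) //= tr.
by case: (tnth t q); rewrite ?addnA.
Qed.

Lemma one_hot_inj t t' : one_hot t -> one_hot t' ->
  (t == t') = (label_of t == label_of t').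
Proof.
move=> ht ht'; apply/eqP/eqP => [->//|tt']; apply: eq_from_tnth => q.
by rewrite !one_hotP // tt'.
Qed.

(** Coordinates are measurable, so a singleton is a finite intersection of measurable sets, and any
    set of tuples is a finite union of singletons. *)
Lemma measurable_bool_tuple (A : set (Q.-tuple bool)) : measurable A.
Proof.
have m1 (t : Q.-tuple bool) : measurable [set t].
  rewrite (_ : [set t] = \bigcap_(i in [set: 'I_Q])
      ((fun s : Q.-tuple bool => tnth s i) @^-1` [set tnth t i])).
    apply: fin_bigcap_measurable => // i _; rewrite -[X in measurable X]setTI.
    exact: measurable_tnth.
  apply/seteqP; split => [s -> //|s st]; apply: eq_from_tnth => i; exact: st.
rewrite (_ : A = \bigcup_(t in A) [set t]); last first.
  by apply/seteqP; split => [t At|t [s As ->]] //; exists t.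
by apply: fin_bigcup_measurable => //; exact: finite_finset.
Qed.

End OneHot.

Section EdgeMoments.
Context (d : measure_display) (T : measurableType d) (R : realType).
Context (P : probability T R) (Q : nat) (p : 'I_Q -> R) (alpha beta : R).
Context (Z : nat -> {RV P >-> Q.-tuple bool}) (X : nat -> nat -> {RV P >-> bool}).
Context (q0 : 'I_Q).
Hypothesis model : binary_affiliation_model p alpha beta Z X.

Local Notation "''E' f" := (Rintegral P setT f) (at level 10, f at level 8).
Local Notation C := (fun i w => label_of q0 (Z i w)).

Definition affinity (x y : 'I_Q) : R := if x == y then alpha else beta.

Lemma ae_one_hot : {ae P, forall w, forall i, one_hot (Z i w)}.
Proof.
case: model => [[h1 _ _] _ _ _].
by apply: ae_foralln => i; apply: filterS (h1 i) => w /eqP.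
Qed.

Lemma measurable_label i (A : set (Q.-tuple bool)) : measurable (Z i @^-1` A).
Proof.
rewrite -[X in measurable X]setTI; apply: measurable_funP => //.
exact: measurable_bool_tuple.
Qed.

Lemma label_law (s : seq nat) z : uniq s ->
  'E (fun w => (all (fun i => C i w == z i) s)%:R) = \prod_(i <- s) p (z i).
Proof.
move=> us; case: model => [[_ h2 h3] _ _ _].
have mZ i : measurable [set w | tnth (Z i w) (z i)].
  exact: (measurable_label i [set t : Q.-tuple bool | tnth t (z i)]).
have bigE : \bigcap_(i in [set` s]) [set w | tnth (Z i w) (z i)] =
    [set w | all (fun i => tnth (Z i w) (z i)) s].
  by apply/seteqP; split => w /= => [h|/allP h i]; [apply/allP|exact: h].
have mB : measurable [set w | all (fun i => tnth (Z i w) (z i)) s].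
  by rewrite -bigE; apply: fin_bigcap_measurable => //; exact: finite_seq.
(* The model gives the law of the coordinates, and having label [z i] amounts to having coordinate
   [z i] true for one-hot vectors only, hence almost surely. *)
have -> : 'E (fun w => (all (fun i => C i w == z i) s)%:R) =
    'E (fun w => (all (fun i => tnth (Z i w) (z i)) s)%:R).
  apply: (@eq_expect_ae _ _ _ P).
  - apply: bounded_measurable_nat; apply: measurable_all_labels => i q.
    exact: (measurable_label i [set t | label_of q0 t == q]).
  - exact: bounded_measurable_nat.
  - apply: filterS ae_one_hot => w h; congr (nat_of_bool _)%:R.
    by apply: eq_all => i; rewrite (one_hotP q0) // eq_sym.
rewrite (@expect_nat _ _ _ P) // -bigE h3 //; last first.
  move=> i _; exists [set t : Q.-tuple bool | tnth t (z i)].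
    exact: measurable_bool_tuple.
  by rewrite setTI.
rewrite (eq_bigr (fun i => (p (z i))%:E)); last by move=> i _; rewrite h2.
by rewrite prodEFin.
Qed.

Lemma bounded_measurable_affinity i j :
  bounded_measurable (fun w => affinity (C i w) (C j w)).
Proof.
split; last first.
  by exists (Num.max `|alpha| `|beta|) => w; rewrite /affinity; case: ifP => _;
    rewrite le_max lexx ?orbT.
apply: measurable_fun_ifT; [|exact: measurable_cst..].
apply: (measurable_fun_bool true); rewrite setTI.
rewrite (_ : _ @^-1` _ = \bigcup_(q in [set: 'I_Q])
   (Z i @^-1` [set t | label_of q0 t = q] `&` Z j @^-1` [set t | label_of q0 t = q])).
  apply: fin_bigcup_measurable => // q _.
  by apply: measurableI; exact: measurable_label.
apply/seteqP; split => [w /= /eqP h|w [q _ [/= -> ->]]]; last exact: eqxx.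
by exists (label_of q0 (Z j w)).
Qed.

Lemma bounded_measurable_edge i j : bounded_measurable (edge X i j).
Proof.
apply: bounded_measurable_nat; rewrite -[X in measurable X]setTI.
exact: (measurable_funP (X i j) measurableT [set b | b]).
Qed.

(** Canonical form of an undirected edge: the model states conditional independence for increasing
    pairs only, and two pairs are the same edge when their canonical forms agree. *)
Definition ordered_pair (e : nat * nat) : nat * nat :=
  if (e.1 < e.2)%N then e else (e.2, e.1).

(** Conditional independence makes the product of the connectivities a version of the conditional
    probability that all edges are present; testing this version on the whole space gives the
    expectation. *)
Lemma expect_edges (s : seq (nat * nat)) :
  all (fun e => e.1 != e.2) s -> uniq (map ordered_pair s) ->
  'E (fun w => \prod_(e <- s) edge X e.1 e.2 w) =
  'E (fun w => \prod_(e <- s) affinity (C e.1 w) (C e.2 w)).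
Proof.
move=> /allP ne us; case: (model) => [_ h1 h2 h3].
pose f (e : nat * nat) w : R := if Z e.1 w == Z e.2 w then alpha else beta.
have lt_s e : e \in map ordered_pair s -> (e.1 < e.2)%N.
  case/mapP => -[i j] /ne /= ij ->; rewrite /ordered_pair /=.
  by case: ifP => //=; case: ltngtP ij.
pose E (e : nat * nat) := [set w | X e.1 e.2 w = true].
have [_ _ /(_ setT)] : is_cond_prob P
    (sigma_family (fun k => (Z k : T -> Q.-tuple bool)))
    (\bigcap_(i in [set` map ordered_pair s]) E i)
    (fun w => \prod_(e <- map ordered_pair s) f e w).
  apply: h2 us _ => e /lt_s e12; split => //.
    by exists [set true] => //; rewrite setTI.
  exact: h1 e12 true.
rewrite setTI => /(_ _) h.
have {}h : 'E (fun w => \prod_(e <- map ordered_pair s) f e w) =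
    fine (P (\bigcap_(i in [set` map ordered_pair s]) E i)).
  by rewrite /Rintegral h // -setC0 -setTD; apply: sigma_algebraCD; exact: sigma_algebra0.
have mE e : measurable (E e).
  rewrite -[X in measurable X]setTI.
  exact: (measurable_funP (X e.1 e.2) measurableT [set true]).
have bigE : \bigcap_(i in [set` map ordered_pair s]) E i =
    [set w | all (fun e => X e.1 e.2 w) (map ordered_pair s)].
  by apply/seteqP; split => w /= => [k|/allP k i]; [apply/allP|exact: k].
rewrite bigE -expect_nat in h; last first.
  by rewrite -bigE; apply: fin_bigcap_measurable => //; exact: finite_seq.
transitivity ('E (fun w => (all (fun e => X e.1 e.2 w) (map ordered_pair s))%:R) : R).
  apply: eq_Rintegral => w _; rewrite /edge -natr_prod; congr _%:R.
  rewrite all_map; elim: s ne {us lt_s h bigE} => [|e s IHs] ne.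
    by rewrite big_nil.
  rewrite big_cons IHs => [|i si]; last by apply: ne; rewrite inE si orbT.
  rewrite /= /ordered_pair; case: ifP => [_|]; first by rewrite mulnb.
  by rewrite /= h3 1?eq_sym ?ne ?mem_head // mulnb.
(* The model compares label vectors while [affinity] compares labels; the two agree almost
   surely. *)
rewrite -h; apply: (@eq_expect_ae _ _ _ P).
- apply: bounded_measurable_prod => e; split; last first.
    by exists (Num.max `|alpha| `|beta|) => w; rewrite /f; case: ifP => _;
      rewrite le_max lexx ?orbT.
  apply: measurable_fun_ifT; [|exact: measurable_cst..].
  apply: (measurable_fun_bool true); rewrite setTI.
  rewrite (_ : _ @^-1` _ = \bigcup_(q in [set: Q.-tuple bool])
     (Z e.1 @^-1` [set q] `&` Z e.2 @^-1` [set q])).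
    apply: fin_bigcup_measurable => [|q _]; first exact: finite_finset.
    by apply: measurableI; exact: measurable_label.
  apply/seteqP; split => [w /= /eqP k|w [q _ [/= -> ->]]]; last exact: eqxx.
  by exists (Z e.2 w).
- - by apply: bounded_measurable_prod => e; exact: bounded_measurable_affinity.
- have := ae_one_hot; apply: filterS => w oh; rewrite big_map; apply: eq_bigr => e _.
  rewrite /f /affinity -one_hot_inj // /ordered_pair.
  by case: ltnP => _ //=; rewrite eq_sym.
Qed.

Lemma expect_edges_avg (u : seq nat) (s : seq (nat * nat)) z :
  uniq u -> all (fun e => (e.1 \in u) && (e.2 \in u)) s ->
  all (fun e => e.1 != e.2) s -> uniq (map ordered_pair s) ->
  'E (fun w => \prod_(e <- s) edge X e.1 e.2 w) =
  label_avg p u (fun z => \prod_(e <- s) affinity (z e.1) (z e.2)) z.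
Proof.
move=> uu /allP su s1 s2; rewrite expect_edges //.
apply: (@expect_labels _ _ _ P _ p C) => //.
- by move=> i q; exact: (measurable_label i [set t | label_of q0 t == q]).
- exact: label_law.
- move=> x y xy; rewrite big_seq [RHS]big_seq; apply: eq_bigr => e /su /andP[e1 e2].
  by rewrite !xy.
- - by apply: bounded_measurable_prod => e; exact: bounded_measurable_affinity.
Qed.

End EdgeMoments.

(** * Averages over triples of nodes *)

Lemma subset_card_sum_le (R : realType) (I : finType) (s : seq I) :
  \sum_(x : I) (x \in s)%:R <= (size s)%:R :> R.
Proof.
rewrite -natr_sum ler_nat -big_mkcond /= sum1_card; exact: card_size.
Qed.

Section TripleSums.
Context (R : realType) (n : nat).

Lemma sum_third (i j : 'I_n) (c : R) :
  \sum_(k < n | uniq [:: i; j; k]) c = (if i != j then n%:R - 2 else 0) * c.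
Proof.
case: eqVneq => [->|ij] /=.
  by rewrite mul0r big_pred0 // => k; rewrite !inE eqxx.
rewrite (eq_bigl (fun k => k \notin [set i; j]%SET)); last first.
  by move=> k; rewrite !inE !(eq_sym k) (negbTE ij) /= andbT negb_or.
rewrite sumr_const -[LHS]mulr_natl; congr (_ * _).
have := cardsC [set i; j]%SET; rewrite cards2 ij card_ord => h.
rewrite -[X in _ = X%:R - _]h natrD addrC addKr.
congr _%:R.
by apply: eq_card => k; rewrite [RHS]inE.
Qed.

Lemma sum_triples (c : R) :
  \sum_(i < n) \sum_(j < n) \sum_(k < n | uniq [:: i; j; k]) c =
  n%:R * (n%:R - 1) * (n%:R - 2) * c.
Proof.
under eq_bigr => i _ do under eq_bigr => j _ do rewrite sum_third.
transitivity (\sum_(i < n) (n%:R - 1) * (n%:R - 2) * c).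
  apply: eq_bigr => i _; rewrite -mulr_suml; congr (_ * _).
  rewrite -big_mkcond /= sumr_const -[LHS]mulr_natl; congr (_ * _).
  have := cardC1 i; rewrite card_ord => h.
  have n0 : (0 < n)%N by apply: leq_ltn_trans (ltn_ord i).
  rewrite -[in RHS](prednK n0) -natr1 addrK -h; congr _%:R.
  by apply: eq_card => k; rewrite !inE eq_sym.
by rewrite sumr_const card_ord -[LHS]mulr_natl !mulrA.
Qed.

(** With [s] the indicator of a fixed triple, this bounds the number of triples meeting it, of order
    [n ^ 2]. *)
Lemma sum_triples_add (s : 'I_n -> R) :
  \sum_i \sum_j \sum_k (s i + s j + s k) = 3 * n%:R ^+ 2 * \sum_i s i.
Proof.
set S := \sum_i s i.
have c (r : R) : \sum_(k < n) r = n%:R * r by rewrite sumr_const card_ord mulr_natl.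
transitivity (\sum_i (n%:R * (n%:R * s i + S) + n%:R * S)); last first.
  by rewrite big_split /= -mulr_sumr big_split /= -mulr_sumr !c -/S; ring.
apply: eq_bigr => i _; transitivity (\sum_j (n%:R * (s i + s j) + S)).
  by apply: eq_bigr => j _; rewrite big_split /= c.
by rewrite big_split /= -mulr_sumr big_split /= !c.
Qed.

(** With [s] the indicator of a fixed triple, this bounds the number of triples having two nodes in
    it, of order [n]. *)
Lemma sum_triples_mul (s : 'I_n -> R) :
  \sum_i \sum_j \sum_k (s i * s j + s i * s k + s j * s k) =
  3 * n%:R * (\sum_i s i) ^+ 2.
Proof.
set S := \sum_i s i.
have c (r : R) : \sum_(k < n) r = n%:R * r by rewrite sumr_const card_ord mulr_natl.
transitivity (\sum_i (2 * n%:R * S * s i + S * S)); last first.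
  by rewrite big_split /= -mulr_sumr c -/S; ring.
apply: eq_bigr => i _; transitivity (\sum_j ((n%:R * s i + S) * s j + s i * S)).
  apply: eq_bigr => j _; rewrite 2!big_split /= c -!mulr_sumr -/S; ring.
by rewrite big_split /= -mulr_sumr c -/S; ring.
Qed.

End TripleSums.

Lemma expect_sqr_sum_le (d : measure_display) (T : measurableType d)
    (R : realType) (P : probability T R) (I : finType) (A : pred I)
    (F : I -> T -> R) (c : I -> I -> R) :
  (forall i, A i -> bounded_measurable (F i)) ->
  (forall i j, A i -> A j -> Rintegral P setT (fun w => F i w * F j w) <= c i j) ->
  Rintegral P setT (fun w => (\sum_(i | A i) F i w) ^+ 2) <=
  \sum_(i | A i) \sum_(j | A j) c i j.
Proof.
move=> hF hc.
rewrite (_ : (fun w => _) =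
    fun w => \sum_(i | A i) \sum_(j | A j) F i w * F j w); last first.
  by apply/funext => w; rewrite expr2 mulr_suml; apply: eq_bigr => i _; rewrite mulr_sumr.
rewrite expect_sum => [|i Ai]; last first.
  by apply: bounded_measurable_sum => j Aj; apply: bounded_measurableM; exact: hF.
apply: ler_sum => i Ai; rewrite expect_sum => [|j Aj]; last first.
  by apply: bounded_measurableM; exact: hF.
by apply: ler_sum => j Aj; exact: hc.
Qed.

(** * Second moments of centered motif averages *)

Section UStatistic.
Context (d : measure_display) (T : measurableType d) (R : realType).
Context (P : probability T R) (Q : nat) (p : 'I_Q -> R) (alpha beta : R).
Context (Z : nat -> {RV P >-> Q.-tuple bool}) (X : nat -> nat -> {RV P >-> bool}).
Context (q0 : 'I_Q).
Hypothesis model : binary_affiliation_model p alpha beta Z X.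

Local Notation "''E' f" := (Rintegral P setT f) (at level 10, f at level 8).
Local Notation aff := (affinity alpha beta).

Definition simple_edges (t : seq nat) (s : seq (nat * nat)) : bool :=
  [&& all (fun e => (e.1 \in t) && (e.2 \in t)) s,
      all (fun e => e.1 != e.2) s & uniq (map ordered_pair s)].

Definition edge_weight (s : seq (nat * nat)) (z : nat -> 'I_Q) : R :=
  \prod_(e <- s) aff (z e.1) (z e.2).

Definition edge_prod (s : seq (nat * nat)) (w : T) : R :=
  \prod_(e <- s) edge X e.1 e.2 w.

Lemma bounded_measurable_edge_prod s : bounded_measurable (edge_prod s).
Proof. by apply: bounded_measurable_prod => e; exact: bounded_measurable_edge. Qed.

Lemma edge_prod_itv s w : 0 <= edge_prod s w <= 1.
Proof.
rewrite /edge_prod; elim: s => [|e s IHs]; first by rewrite big_nil lexx ler01.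
rewrite big_cons /edge; case: (X _ _ w); rewrite /= ?mulr1n ?mulr0n ?mul1r //.
by rewrite mul0r lexx ler01.
Qed.

Lemma supported_edge_weight t s : simple_edges t s -> supported t (edge_weight s).
Proof.
case/and3P=> /allP h _ _ z z' zz'; rewrite /edge_weight big_seq [RHS]big_seq.
by apply: eq_bigr => e /h /andP[e1 e2]; rewrite !zz'.
Qed.

Lemma expect_edge_prod t s z : uniq t -> simple_edges t s ->
  'E (edge_prod s) = label_avg p t (edge_weight s) z.
Proof. by move=> ut /and3P[h1 h2 h3]; exact: (expect_edges_avg q0 model). Qed.

(* Triples with at most one common node have no common edge. *)
Lemma expect_edge_prodM (t1 t2 : seq nat) s1 s2 z (m1 m2 : R) :
  uniq t1 -> uniq t2 -> simple_edges t1 s1 -> simple_edges t2 s2 ->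
  (forall x y, x \in t1 -> x \in t2 -> y \in t1 -> y \in t2 -> x = y) ->
  label_avg p t1 (edge_weight s1) z = m1 ->
  (forall y, label_avg p [seq x <- t2 | x \notin t1] (edge_weight s2) y = m2) ->
  'E (fun w => edge_prod s1 w * edge_prod s2 w) = m1 * m2.
Proof.
move=> ut1 ut2 hs1 hs2 t12 h1 h2.
pose v := [seq x <- t2 | x \notin t1].
have cup x : x \in t2 -> x \in t1 ++ v.
  by move=> xt; rewrite mem_cat mem_filter xt andbT orbN.
have -> : 'E (fun w => edge_prod s1 w * edge_prod s2 w) = 'E (edge_prod (s1 ++ s2)).
  by apply: eq_Rintegral => w _; rewrite /edge_prod big_cat.
have vt1 : ~~ has (mem t1) v by apply/hasPn => x; rewrite mem_filter => /andP[].
rewrite (@expect_edge_prod (t1 ++ v) _ z); first last.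
- case/and3P: hs1 => a1 b1 c1; case/and3P: hs2 => a2 b2 c2; apply/and3P; split.
  + rewrite all_cat; apply/andP; split; apply/allP => e.
      by move=> /(allP a1) /andP[e1 e2]; rewrite !mem_cat e1 e2.
    by move=> /(allP a2) /andP[e1 e2]; rewrite !cup.
  + by rewrite all_cat b1 b2.
  + rewrite map_cat cat_uniq c1 c2 andbT /=; apply/hasPn => _ /mapP[[e e'] es2 ->].
    apply/negP => /mapP[[f f'] fs1 ef].
    have /andP[/= e1 e2] := allP a2 _ es2; have /andP[/= f1 f2] := allP a1 _ fs1.
    have /eqP[] := allP b2 _ es2; move: ef; rewrite /ordered_pair /=.
    by case: ifP; case: ifP => _ _ [] ee ff; apply: t12; rewrite ?ee ?ff // -?ee -?ff.
- by rewrite cat_uniq ut1 vt1 filter_uniq.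
rewrite -h1 -(@label_avg_prod _ _ p t1 v (edge_weight s1) (edge_weight s2)) //.
- by apply: eq_label_avg => y; rewrite /edge_weight big_cat.
- exact: supported_edge_weight.
Qed.

Context (E : nat -> nat -> nat -> seq (nat * nat)) (mu : R).
Hypothesis simpleE : forall i j k, uniq [:: i; j; k] -> simple_edges [:: i; j; k] (E i j k).
Hypothesis meanE : forall i j k z, uniq [:: i; j; k] ->
  label_avg p [:: i; j; k] (edge_weight (E i j k)) z = mu.

Local Notation F i j k := (fun w => edge_prod (E i j k) w - mu).

Definition triple_stat (n : nat) (w : T) : R :=
  (n%:R * (n%:R - 1) * (n%:R - 2))^-1 *
  \sum_(i < n) \sum_(j < n) \sum_(k < n | uniq [:: i; j; k]) edge_prod (E i j k) w.

Lemma expect_triple i j k : uniq [:: i; j; k] -> 'E (edge_prod (E i j k)) = mu.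
Proof.
by move=> u; rewrite (@expect_edge_prod [:: i; j; k] _ (fun=> q0)) ?meanE ?simpleE.
Qed.

(** The number [mu] is the expectation of an indicator, namely that of the motif on the nodes 0, 1,
    2. *)
Lemma mean_itv : 0 <= mu <= 1.
Proof.
rewrite -(@expect_triple 0 1 2) //; apply/andP; split.
  by apply: Rintegral_ge0 => w _; case/andP: (edge_prod_itv (E 0 1 2) w).
rewrite -[leRHS](@expect_cst _ _ _ P); apply: le_expect => [||w].
- exact: bounded_measurable_edge_prod.
- exact: bounded_measurable_cst.
- by case/andP: (edge_prod_itv (E 0 1 2) w).
Qed.

Lemma bounded_measurable_centered i j k : bounded_measurable (F i j k).
Proof.
apply: bounded_measurableB; first exact: bounded_measurable_edge_prod.
exact: bounded_measurable_cst.
Qed.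

Lemma expect_centeredM_le1 i j k i' j' k' :
  'E (fun w => F i j k w * F i' j' k' w) <= 1.
Proof.
rewrite -[leRHS](@expect_cst _ _ _ P); apply: le_expect => [||w].
- by apply: bounded_measurableM; exact: bounded_measurable_centered.
- exact: bounded_measurable_cst.
have b a : 0 <= a <= 1 -> `|a - mu| <= 1.
  by move=> /andP[a0 a1]; have /andP[m0 m1] := mean_itv; rewrite ler_norml; lra.
apply: le_trans (ler_norm _) _; rewrite normrM -[leRHS]mulr1 ler_pM //;
  apply: b; exact: edge_prod_itv.
Qed.

(** The source of both rates. The last hypothesis averages the second motif over its own new nodes
    only: for disjoint triples it is [meanE], for triples with one common node it is the
    degeneracy. *)
Lemma expect_centeredM_eq0 i j k i' j' k' :
  let t := [:: i; j; k] in let t' := [:: i'; j'; k'] in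
  uniq t -> uniq t' ->
  (forall x y, x \in t -> x \in t' -> y \in t -> y \in t' -> x = y) ->
  (forall z, label_avg p [seq x <- t' | x \notin t] (edge_weight (E i' j' k')) z = mu) ->
  'E (fun w => F i j k w * F i' j' k' w) = 0.
Proof.
move=> t t' ut ut' tt' h.
have bE := bounded_measurable_edge_prod.
rewrite (_ : (fun w => _) = fun w => edge_prod (E i j k) w * edge_prod (E i' j' k') w -
  (mu * edge_prod (E i j k) w + mu * edge_prod (E i' j' k') w - mu ^+ 2)); last first.
  by apply/funext => w; ring.
have bM s : bounded_measurable (fun w => mu * edge_prod s w).
  by apply: bounded_measurableM => //; exact: bounded_measurable_cst.
have bD : bounded_measurable
    (fun w => mu * edge_prod (E i j k) w + mu * edge_prod (E i' j' k') w).
  exact: bounded_measurableD.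
have bc := bounded_measurable_cst T (mu ^+ 2).
rewrite expectB; [|exact: bounded_measurableM|exact: bounded_measurableB].
rewrite expectB // expectD // !(expectZ _ _ (bE _)) !expect_triple // expect_cst.
rewrite (@expect_edge_prodM t t' _ _ (fun=> q0) mu mu) ?simpleE //; first by ring.
exact: meanE.
Qed.

(* [81 / 4 = (9 / 2) ^ 2] comes from [n (n - 1) (n - 2) >= 2 / 9 n ^ 3] for [n >= 3]. *)
Lemma expect_sqr_triple_stat_le n (b : R)
    (c : 'I_n -> 'I_n -> 'I_n -> 'I_n -> 'I_n -> 'I_n -> R) :
  (3 <= n)%N ->
  (forall i j k i' j' k' : 'I_n, uniq [:: i; j; k] -> uniq [:: i'; j'; k'] ->
    'E (fun w => F i j k w * F i' j' k' w) <= c i j k i' j' k') ->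
  (forall i j k, \sum_i' \sum_j' \sum_k' c i j k i' j' k' <= b) ->
  (forall i j k i' j' k', 0 <= c i j k i' j' k') ->
  'E (fun w => (triple_stat n w - mu) ^+ 2) <= 81 / 4 * b / n%:R ^+ 3.
Proof.
move=> n3 hc hb c0; set N : R := n%:R.
have N3 : 3 <= N by rewrite /N ler_nat.
set D := N * (N - 1) * (N - 2).
have D0 : 0 < D by rewrite /D !mulr_gt0 //; lra.
pose A (t : 'I_n * 'I_n * 'I_n) := uniq [:: t.1.1; t.1.2; t.2].
pose G (t : 'I_n * 'I_n * 'I_n) := F t.1.1 t.1.2 t.2.
have UE w : triple_stat n w - mu = D^-1 * \sum_(t | A t) G t w.
  rewrite /triple_stat -/N -/D.
  have -> : \sum_(t | A t) G t w = \sum_(i < n) \sum_(j < n)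
      \sum_(k < n | uniq [:: i; j; k]) (edge_prod (E i j k) w - mu).
    by rewrite !pair_big_dep /=.
  under [in RHS]eq_bigr => i _ do under eq_bigr => j _ do rewrite big_split /=.
  under [in RHS]eq_bigr => i _ do rewrite big_split /=.
  rewrite big_split /= sum_triples mulrDr -/N -/D mulKf ?gt_eqF //.
have -> : 'E (fun w => (triple_stat n w - mu) ^+ 2) =
    D ^- 2 * 'E (fun w => (\sum_(t | A t) G t w) ^+ 2).
  rewrite -expectZ; last first.
    apply: bounded_measurableX; apply: bounded_measurable_sum => t _.
    exact: bounded_measurable_centered.
  by apply: eq_Rintegral => w _; rewrite UE exprMn exprVn.
have b0 : 0 <= b.
  have i0 : 'I_n by apply: (@Ordinal n 0); exact: leq_trans n3.
  apply: le_trans (hb i0 i0 i0).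
  by do 3 (apply: sumr_ge0 => ? _).
(* There are at most [n ^ 3] choices of the first triple, and each contributes at most [b]. *)
have S : 'E (fun w => (\sum_(t | A t) G t w) ^+ 2) <= N ^+ 3 * b.
  apply: (@le_trans _ _ (\sum_(t | A t) \sum_(t' | A t')
      c t.1.1 t.1.2 t.2 t'.1.1 t'.1.2 t'.2)).
    apply: expect_sqr_sum_le => [t _|t t' At At'].
      exact: bounded_measurable_centered.
    exact: hc.
  apply: (@le_trans _ _ (\sum_(t : 'I_n * 'I_n * 'I_n) b)).
    rewrite big_mkcond /=; apply: ler_sum => t _; case: ifP => // _.
    apply: le_trans (hb t.1.1 t.1.2 t.2); rewrite !pair_bigA /= big_mkcond /=.
    by apply: ler_sum => t' _; case: ifP.
  by rewrite sumr_const !card_prod card_ord -[X in X <= _]mulr_natl !natrM exprS expr2 mulrA.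
apply: le_trans (ler_wpM2l _ S) _; first by rewrite invr_ge0 exprn_ge0 // ltW.
have DN : 4 / 81 * N ^+ 6 <= D ^+ 2.
  rewrite (_ : 4 / 81 * N ^+ 6 = (N * (2 / 3 * N) * (1 / 3 * N)) ^+ 2); last by field.
  have h0 : 0 <= N * (2 / 3 * N) by rewrite mulr_ge0 //; lra.
  have h1 : 0 <= 1 / 3 * N by lra.
  apply: lerXn2r; rewrite ?nnegrE ?(ltW D0) ?mulr_ge0 //.
  by rewrite /D !ler_pM //; lra.
have N0 : 0 < N by lra.
rewrite mulrC ler_pdivrMr ?exprn_gt0 // [leRHS]mulrAC ler_pdivlMr ?exprn_gt0 //.
have -> : N ^+ 3 * b * N ^+ 3 = b * N ^+ 6 by ring.
have -> : 81 / 4 * b * D ^+ 2 = b * (81 / 4 * D ^+ 2) by ring.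
by apply: ler_wpM2l => //; lra.
Qed.

(** The majorant of a covariance counts the entries of the second triple lying in the first. It is
    at least 1 once a node is shared, and its sum is at most [3 n ^ 2 * 3], whence
    [729 / 4 = 81 / 4 * 9]. *)
Lemma expect_sqr_triple_stat n : (3 <= n)%N ->
  'E (fun w => (triple_stat n w - mu) ^+ 2) <= 729 / 4 / n%:R.
Proof.
move=> n3; have N0 : 0 < n%:R :> R by rewrite ltr0n; exact: leq_trans n3.
pose a (i j k x : 'I_n) : R := (x \in [:: i; j; k])%:R.
have a0 i j k x : 0 <= a i j k x by exact: ler0n.
have sa i j k : \sum_x a i j k x <= 3 by exact: (subset_card_sum_le R [:: i; j; k]).
apply: le_trans (@expect_sqr_triple_stat_le n (9 * n%:R ^+ 2)
  (fun i j k i' j' k' => a i j k i' + a i j k j' + a i j k k') n3 _ _ _) _.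
- move=> i j k i' j' k' u u'; rewrite /a.
  have le1 := expect_centeredM_le1 i j k i' j' k'.
  have [ii|ii] := boolP (i' \in _); first by rewrite (le_trans le1) // -addrA lerDl addr_ge0.
  have [jj|jj] := boolP (j' \in _); first by rewrite (le_trans le1) // add0r lerDl.
  have [kk|kk] := boolP (k' \in _); first by rewrite (le_trans le1) // !add0r.
  have tt' x : x \in [:: i : nat; j : nat; k : nat] ->
      x \in [:: i' : nat; j' : nat; k' : nat] -> False.
    move=> xt; rewrite !inE => /or3P[]/eqP xx; move: xt; rewrite xx.
    + by move/negP: ii; rewrite !inE.
    + by move/negP: jj; rewrite !inE.
    + by move/negP: kk; rewrite !inE.
  rewrite expect_centeredM_eq0 //.
  + by move=> x y xt /(tt' _ xt).
  + move=> z; rewrite (_ : [seq _ <- _ | _] = [:: i' : nat; j' : nat; k' : nat]).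
      by rewrite meanE //; move: u'; rewrite -(map_inj_uniq val_inj).
    by apply/all_filterP/allP => x xt'; apply/negP => /tt'; exact.
- move=> i j k.
  rewrite (sum_triples_add (a i j k)).
  rewrite (_ : 9 * _ = 3 * n%:R ^+ 2 * 3); last by ring.
  by apply: ler_wpM2l => //; rewrite mulr_ge0 // exprn_ge0 // ltW.
- by move=> *; rewrite !addr_ge0.
- by rewrite le_eqVlt; apply/orP; left; apply/eqP; field; rewrite gt_eqF.
Qed.

(* Under this degeneracy only triples with two common nodes are correlated. *)
Lemma expect_sqr_degenerate_triple_stat n : (3 <= n)%N ->
  (forall i j k z, uniq [:: i; j; k] ->
    [/\ label_avg p [:: j; k] (edge_weight (E i j k)) z = mu,
        label_avg p [:: i; k] (edge_weight (E i j k)) z = mu &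
        label_avg p [:: i; j] (edge_weight (E i j k)) z = mu]) ->
  'E (fun w => (triple_stat n w - mu) ^+ 2) <= 2187 / 4 / n%:R ^+ 2.
Proof.
move=> n3 degE; have N0 : 0 < n%:R :> R by rewrite ltr0n; exact: leq_trans n3.
pose a (i j k x : 'I_n) : R := (x \in [:: i; j; k])%:R.
have a0 i j k x : 0 <= a i j k x by exact: ler0n.
have sa i j k : \sum_x a i j k x <= 3 by exact: (subset_card_sum_le R [:: i; j; k]).
(* This majorant counts pairs of entries lying in the first triple, so it reaches 1 only when two
   nodes are shared; its sum is at most [3 n * 3 ^ 2]. *)
apply: le_trans (@expect_sqr_triple_stat_le n (27 * n%:R)
  (fun i j k i' j' k' => a i j k i' * a i j k j' + a i j k i' * a i j k k' +
     a i j k j' * a i j k k') n3 _ _ _) _.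
- move=> i j k i' j' k' u u'; rewrite /a.
  have le1 := expect_centeredM_le1 i j k i' j' k'.
  have nu : uniq [:: i : nat; j : nat; k : nat].
    by move: u; rewrite -(map_inj_uniq val_inj).
  have nu' : uniq [:: i' : nat; j' : nat; k' : nat].
    by move: u'; rewrite -(map_inj_uniq val_inj).
  have memE (x : 'I_n) : (x \in [:: i; j; k]) = ((x : nat) \in [:: i : nat; j : nat; k : nat]).
    by rewrite !inE.
  rewrite !memE; set t := [:: (i : nat); (j : nat); (k : nat)].
  (* The new nodes of the second triple are either all three, covered by [meanE], or two of them,
     covered by [degE]. *)
  have cov0 : (((i' : nat) \in t) + ((j' : nat) \in t) + ((k' : nat) \in t) <= 1)%N ->
      'E (fun w => F i j k w * F i' j' k' w) = 0.
    have filterE (b : pred nat) : [seq x <- [:: i' : nat; j' : nat; k' : nat] | b x] =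
        (if b i' then cons (i' : nat) else id) ((if b j' then cons (j' : nat) else id)
          (if b k' then [:: k' : nat] else [::])).
      by rewrite /=; case: (b i'); case: (b j').
    have mem3 x : x \in [:: i' : nat; j' : nat; k' : nat] ->
        [\/ x = i', x = j' | x = k'].
      by rewrite !inE => /or3P[]/eqP ->; [exact: Or31|exact: Or32|exact: Or33].
    case ii: ((i' : nat) \in t); case jj: ((j' : nat) \in t);
      case kk: ((k' : nat) \in t) => // _;
      apply: expect_centeredM_eq0 => // [x y xt xt' yt yt'|z];
      try (by rewrite -/t filterE ii jj kk; first [exact: meanE | case: (degE _ _ _ z nu')]);
      by move: xt yt; case: (mem3 _ xt') => ->; case: (mem3 _ yt') => ->;
        rewrite -/t ?ii ?jj ?kk.
  move: cov0; case: (_ \in _); case: (_ \in _); case: (_ \in _) => /= cov0;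
    rewrite ?mulr1n ?mulr0n ?mulr1 ?mulr0 ?mul0r ?addr0 ?add0r;
    first [by rewrite cov0 | by apply: le_trans le1 _; lra].
- move=> i j k; set s := a i j k.
  rewrite (sum_triples_mul s).
  rewrite (_ : 27 * _ = 3 * n%:R * 3 ^+ 2); last by ring.
  apply: ler_wpM2l; first by rewrite mulr_ge0 // ltW.
  apply: lerXn2r; rewrite ?nnegrE //; last exact: sa.
  by apply: sumr_ge0 => x _; exact: a0.
- by move=> *; rewrite !addr_ge0 // mulr_ge0.
- by rewrite le_eqVlt; apply/orP; left; apply/eqP; field; rewrite gt_eqF.
Qed.

End UStatistic.

(** * Means of the three motifs *)

(** The idle node [k] turns the edge density into an average over triples. *)
Definition single_edge (i j k : nat) := [:: (i, j)].
Definition two_star (i j k : nat) := [:: (i, j); (i, k)].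
Definition triangle (i j k : nat) := [:: (i, j); (i, k); (j, k)].

Lemma simple_single_edge i j k :
  uniq [:: i; j; k] -> simple_edges [:: i; j; k] (single_edge i j k).
Proof.
rewrite /simple_edges /= !inE !negb_or !eqxx ?orbT /= !andbT.
by move=> /andP[/andP[-> _] _]; rewrite ?orbT.
Qed.

Lemma simple_triangle i j k : uniq [:: i; j; k] -> simple_edges [:: i; j; k] (triangle i j k).
Proof.
rewrite /simple_edges /= !inE !negb_or !eqxx ?orbT /= !andbT.
move=> /andP[/andP[ij ik] jk]; rewrite ij ik jk /ordered_pair /=.
case: (ltngtP i j) ij => //= ij _; case: (ltngtP i k) ik => //= ik _;
  case: (ltngtP j k) jk => //= jk _; rewrite -!pair_eqE /pair_eq /=; lia.
Qed.

Lemma simple_two_star i j k : uniq [:: i; j; k] -> simple_edges [:: i; j; k] (two_star i j k).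
Proof.
rewrite /simple_edges /= !inE !negb_or !eqxx ?orbT /= !andbT.
move=> /andP[/andP[ij ik] jk]; rewrite ij ik /ordered_pair /=.
by case: (ltngtP i j) ij => //= ij _; case: (ltngtP i k) ik => //= ik _;
  rewrite -!pair_eqE /pair_eq /=; lia.
Qed.

Section Moments.
Context (R : realType) (Q : nat) (p : 'I_Q -> R) (alpha beta : R).
Hypothesis p1 : \sum_(q < Q) p q = 1.

Local Notation aff := (affinity alpha beta).
Local Notation weight := (edge_weight alpha beta).
Local Notation s2 := (\sum_(q < Q) p q ^+ 2).
Local Notation s3 := (\sum_(q < Q) p q ^+ 3).
Local Notation delta := (alpha - beta).

Lemma affinityE (x y : 'I_Q) : aff x y = beta + delta * (x == y)%:R.
Proof. by rewrite /affinity; case: eqP => _; rewrite ?mulr1 ?mulr0 ?addr0 // subrKC. Qed.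

Lemma affinityC (x y : 'I_Q) : aff x y = aff y x.
Proof. by rewrite /affinity eq_sym. Qed.

(** Connectivity is the baseline [beta] plus an excess [delta] on the diagonal; this is what reduces
    all label averages to power sums of [p]. *)
Lemma sum_affinity (x : 'I_Q) (h : 'I_Q -> R) :
  \sum_(r < Q) p r * (aff x r * h r) =
  beta * \sum_(r < Q) p r * h r + delta * (p x * h x).
Proof.
rewrite mulr_sumr [X in _ + X](_ : _ = \sum_(r < Q) delta * ((x == r)%:R * (p r * h r))).
  by rewrite -big_split /=; apply: eq_bigr => r _; rewrite affinityE; ring.
rewrite (bigD1 x) //= eqxx mul1r big1 ?addr0 // => r.
by rewrite eq_sym => /negbTE ->; rewrite mul0r mulr0.
Qed.

Lemma sum_p_cst (c : R) : \sum_(r < Q) p r * c = c.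
Proof. by rewrite -mulr_suml p1 mul1r. Qed.

(** Conditional mean of the triangle indicator given that one of its nodes has label [x]. *)
Definition triangle_given (x : 'I_Q) : R :=
  \sum_(r < Q) p r * \sum_(s < Q) p s * (aff x r * (aff x s * aff r s)).

Lemma sum_affinity1 (x : 'I_Q) : \sum_(s < Q) p s * aff x s = beta + delta * p x.
Proof.
rewrite (eq_bigr (fun s => p s * (aff x s * 1))); last by move=> s _; rewrite mulr1.
by rewrite (sum_affinity _ (fun=> 1)) sum_p_cst !mulr1.
Qed.

Lemma sum_affinity2 (x r : 'I_Q) : \sum_(s < Q) p s * (aff x s * aff r s) =
  beta ^+ 2 + beta * delta * (p x + p r) + delta ^+ 2 * (p x * (x == r)%:R).
Proof. by rewrite sum_affinity sum_affinity1 affinityE eq_sym; ring. Qed.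

(** The label enters through [p x] only: averaging gives the mean of the triangle, and equal
    proportions make the expression constant, which is the degeneracy. *)
Lemma triangle_givenE (x : 'I_Q) :
  triangle_given x = beta ^+ 3 + beta ^+ 2 * delta * s2 + 2 * beta ^+ 2 * delta * p x
    + 3 * beta * delta ^+ 2 * p x ^+ 2 + delta ^+ 3 * p x ^+ 2.
Proof.
rewrite /triangle_given.
rewrite (eq_bigr (fun r => p r * (aff x r *
    (beta ^+ 2 + beta * delta * p x + beta * delta * p r + delta ^+ 2 * (p x * (x == r)%:R))))); last first.
  move=> r _; congr (_ * _); transitivity (aff x r * \sum_(s < Q) p s * (aff x s * aff r s)).
    by rewrite mulr_sumr; apply: eq_bigr => s _; ring.
  by rewrite sum_affinity2; ring.
rewrite (sum_affinity x (fun r => beta ^+ 2 + beta * delta * p x + beta * delta * p r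
    + delta ^+ 2 * (p x * (x == r)%:R))) eqxx.
rewrite (eq_bigr (fun r => p r * (beta ^+ 2 + beta * delta * p x) + (beta * delta * p r ^+ 2 +
    delta ^+ 2 * (p x * ((x == r)%:R * p r))))); last by move=> r _; ring.
rewrite 2!big_split /= sum_p_cst -!mulr_sumr.
have -> : \sum_(r < Q) (x == r)%:R * p r = p x.
  rewrite (bigD1 x) //= eqxx mul1r big1 ?addr0 // => r.
  by rewrite eq_sym => /negbTE ->; rewrite mul0r.
ring.
Qed.

Section Distinct.
Context (i j k : nat) (z : nat -> 'I_Q).
Hypothesis uijk : uniq [:: i; j; k].

Let neqs : ((i == j) = false) * ((j == i) = false) * ((i == k) = false) *
  ((k == i) = false) * ((j == k) = false) * ((k == j) = false).
Proof.
move: uijk; rewrite /= !inE negb_or andbT => /andP[/andP[ij ik] jk].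
by do !split; apply/negbTE => //; rewrite eq_sym.
Qed.

Lemma label_avg_single_edge :
  label_avg p [:: i; j; k] (weight (single_edge i j k)) z = beta + delta * s2.
Proof.
rewrite /= /edge_weight; transitivity (\sum_(q < Q) p q * (beta + delta * p q)).
  apply: eq_bigr => q _; congr (_ * _); rewrite -sum_affinity1; apply: eq_bigr => r _.
  congr (_ * _); rewrite -[RHS]sum_p_cst; apply: eq_bigr => s _; congr (_ * _).
  by rewrite big_cons big_nil mulr1 /relabel /= !neqs !eqxx.
rewrite (eq_bigr (fun q => p q * beta + delta * p q ^+ 2)); last by move=> q _; ring.
by rewrite big_split /= sum_p_cst -mulr_sumr.
Qed.

Lemma label_avg_two_star :
  label_avg p [:: i; j; k] (weight (two_star i j k)) z =
  beta ^+ 2 + 2 * beta * delta * s2 + delta ^+ 2 * s3.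
Proof.
rewrite /= /edge_weight; transitivity (\sum_(q < Q) p q * (beta + delta * p q) ^+ 2).
  apply: eq_bigr => q _; congr (_ * _); rewrite expr2 -{1}sum_affinity1 mulr_suml.
  apply: eq_bigr => r _; rewrite -mulrA; congr (_ * _).
  rewrite -sum_affinity1 mulr_sumr; apply: eq_bigr => s _.
  by rewrite !big_cons big_nil mulr1 /relabel /= !neqs !eqxx mulrCA.
rewrite (eq_bigr (fun q => p q * beta ^+ 2 + (2 * beta * delta * p q ^+ 2
  + delta ^+ 2 * p q ^+ 3))); last by move=> q _; ring.
by rewrite 2!big_split /= sum_p_cst -!mulr_sumr addrA.
Qed.

Lemma label_avg_triangle1 :
  label_avg p [:: j; k] (weight (triangle i j k)) z = triangle_given (z i).
Proof.
rewrite /= /edge_weight; apply: eq_bigr => r _; congr (_ * _); apply: eq_bigr => s _.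
by rewrite !big_cons big_nil mulr1 /relabel /= !neqs !eqxx.
Qed.

Lemma label_avg_triangle2 :
  label_avg p [:: i; k] (weight (triangle i j k)) z = triangle_given (z j).
Proof.
rewrite /= /edge_weight; apply: eq_bigr => r _; congr (_ * _); apply: eq_bigr => s _.
rewrite !big_cons big_nil mulr1 /relabel /= !neqs !eqxx (affinityC r (z j)); ring.
Qed.

Lemma label_avg_triangle3 :
  label_avg p [:: i; j] (weight (triangle i j k)) z = triangle_given (z k).
Proof.
rewrite /= /edge_weight; apply: eq_bigr => r _; congr (_ * _); apply: eq_bigr => s _.
rewrite !big_cons big_nil mulr1 /relabel /= !neqs !eqxx.
rewrite (affinityC r (z k)) (affinityC s (z k)); ring.
Qed.

End Distinct.

Lemma label_avg_triangle i j k z : uniq [:: i; j; k] ->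
  label_avg p [:: i; j; k] (weight (triangle i j k)) z =
  beta ^+ 3 + 3 * beta ^+ 2 * delta * s2 + 3 * beta * delta ^+ 2 * s3 + delta ^+ 3 * s3.
Proof.
move=> u; rewrite -cat1s label_avg_cat [LHS]/=.
transitivity (\sum_(q < Q) p q * triangle_given q).
  apply: eq_bigr => q _; congr (_ * _).
  by rewrite [LHS](label_avg_triangle1 _ u) /relabel eqxx.
rewrite (eq_bigr (fun q => p q * (beta ^+ 3 + beta ^+ 2 * delta * s2)
   + (2 * beta ^+ 2 * delta * p q ^+ 2
   + (3 * beta * delta ^+ 2 + delta ^+ 3) * p q ^+ 3))); last first.
  by move=> q _; rewrite triangle_givenE; ring.
rewrite 2!big_split /= sum_p_cst -!mulr_sumr; ring.
Qed.

Section EqualProportions.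
Context (Q0 : (0 < Q)%N).
Hypothesis p_eq : forall q, p q = Q%:R^-1.

Lemma sum_p2_eq : s2 = Q%:R^-1.
Proof.
rewrite (eq_bigr (fun=> Q%:R^-1 ^+ 2)); last by move=> q _; rewrite p_eq.
rewrite sumr_const card_ord -[LHS]mulr_natl expr2 mulVKf // pnatr_eq0; lia.
Qed.

Lemma sum_p3_eq : s3 = Q%:R^-1 ^+ 2.
Proof.
rewrite (eq_bigr (fun=> Q%:R^-1 ^+ 3)); last by move=> q _; rewrite p_eq.
rewrite sumr_const card_ord -[LHS]mulr_natl exprS mulVKf // pnatr_eq0; lia.
Qed.

Lemma triangle_given_eq x : triangle_given x =
  beta ^+ 3 + 3 * beta ^+ 2 * delta * s2 + 3 * beta * delta ^+ 2 * s3 + delta ^+ 3 * s3.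
Proof. by rewrite triangle_givenE p_eq sum_p3_eq sum_p2_eq; ring. Qed.

(** With one end frozen at label [x] the average is [beta + delta * p x], the same for all labels
    here; with the idle node frozen it is the full mean. *)
Lemma label_avg_single_edge_eq i j k z : uniq [:: i; j; k] ->
  [/\ label_avg p [:: j; k] (weight (single_edge i j k)) z = beta + delta * s2,
      label_avg p [:: i; k] (weight (single_edge i j k)) z = beta + delta * s2 &
      label_avg p [:: i; j] (weight (single_edge i j k)) z = beta + delta * s2].
Proof.
move=> u; have : (i != j) && (i != k) && (j != k).
  by move: u; rewrite /= !inE negb_or andbT.
move=> /andP[/andP[/negbTE ij /negbTE ik] /negbTE jk].
have [ji ki kj] : [/\ (j == i) = false, (k == i) = false & (k == j) = false].
  by rewrite !(eq_sym _ i) (eq_sym k).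
have avg1 x : \sum_(r < Q) p r * aff x r = beta + delta * s2.
  by rewrite sum_affinity1 p_eq sum_p2_eq.
rewrite /= /edge_weight; split.
- rewrite -(avg1 (z i)); apply: eq_bigr => r _; rewrite -(sum_p_cst (aff _ _)); congr (_ * _).
  apply: eq_bigr => s _; rewrite big_cons big_nil mulr1 /relabel /=.
  by rewrite ?ij ?ik ?jk ?ji ?ki ?kj !eqxx.
- rewrite -(avg1 (z j)); apply: eq_bigr => r _; rewrite -(sum_p_cst (aff _ _)); congr (_ * _).
  apply: eq_bigr => s _; rewrite big_cons big_nil mulr1 /relabel /=.
  by rewrite ?ij ?ik ?jk ?ji ?ki ?kj !eqxx affinityC.
- rewrite -[RHS]sum_p_cst; apply: eq_bigr => r _; congr (_ * _); rewrite -(avg1 r).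
  apply: eq_bigr => s _; rewrite big_cons big_nil mulr1 /relabel /=.
  by rewrite ?ij ?ik ?jk ?ji ?ki ?kj !eqxx.
Qed.

End EqualProportions.

End Moments.

(** * Almost sure convergence *)

Section AlmostSure.
Context (d : measure_display) (T : measurableType d) (R : realType).
Context (P : probability T R).

Local Notation "''E' f" := (Rintegral P setT f) (at level 10, f at level 8).

(** For each threshold [1 / (m + 1)], Chebyshev makes the exceedance probabilities summable and
    Borel-Cantelli applies; countably many thresholds suffice. *)
Lemma ae_cvg0_summable_sqr (Y : nat -> T -> R) (a : nat -> R) (B : R) :
  (forall k, bounded_measurable (Y k)) ->
  (forall k, 'E (fun w => Y k w ^+ 2) <= a k) ->
  (forall n, \sum_(k < n) a k <= B) ->
  {ae P, forall w, Y k w @[k --> \oo] --> 0}.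
Proof.
move=> mY hE hB.
have a0 k : 0 <= a k by apply: le_trans (hE k); apply: Rintegral_ge0 => w _; exact: sqr_ge0.
pose A (m k : nat) := [set w | m.+1%:R^-1 < `|Y k w|].
have mA m k : measurable (A m k).
  rewrite -[X in measurable X]setTI.
  have : measurable_fun setT (fun w => `|Y k w|) by case: (bounded_measurable_norm (mY k)).
  by move=> /(_ measurableT `]m.+1%:R^-1, +oo[%classic); rewrite preimage_itvoy; exact.
have PA m k : (P (A m k) <= (m.+1%:R ^+ 2 * a k)%:E)%E.
  apply: le_trans (chebyshev_tail P (mY k) _) _; first by rewrite invr_gt0.
  rewrite lee_fin mulrC exprVn invrK.
  by rewrite ler_pM2l ?hE // exprn_gt0.
have lim0 m : P (lim_sup_set (A m)) = 0%E.
  apply: lim_sup_set_cvg0 => //.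
  apply: (@le_lt_trans _ _ (m.+1%:R ^+ 2 * B)%:E); last exact: ltry.
  apply: lime_le; first exact: is_cvg_nneseries.
  apply: nearW => n; apply: (@le_trans _ _ (\sum_(0 <= k < n) (m.+1%:R ^+ 2 * a k)%:E)%E).
    by apply: lee_sum => k _; exact: PA.
  rewrite sumEFin lee_fin -mulr_sumr big_mkord.
  by rewrite ler_wpM2l // exprn_ge0.
have : {ae P, forall w, forall m, ~ lim_sup_set (A m) w}.
  apply: ae_foralln => m; exists (lim_sup_set (A m)).
  split; [|exact: lim0|by move=> w /= /contrapT].
  by apply: bigcapT_measurable => n; apply: bigcup_measurable => k _; exact: mA.
apply: filterS => w h; apply/cvgrPdist_le => e e0.
have [m me] : exists m : nat, m.+1%:R^-1 <= e.
  exists (Num.trunc e^-1); rewrite invf_ple ?posrE //.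
  by rewrite ltW // truncnS_gt.
have /existsNP[n /not_implyP[_ hn]] := h m.
exists n => // k /= nk; rewrite sub0r normrN; apply: le_trans me.
by rewrite leNgt; apply/negP => Ak; apply: hn; exists k.
Qed.

End AlmostSure.

(** * Interpolation between consecutive squares *)

Section Interpolation.
Context (R : realType).

Definition triple_sum (f : nat -> nat -> nat -> R) (n : nat) : R :=
  \sum_(i < n) \sum_(j < n) \sum_(k < n) f i j k.

Lemma ler_sum_ord (g : nat -> R) m n : (forall i, 0 <= g i) -> (m <= n)%N ->
  \sum_(i < m) g i <= \sum_(i < n) g i.
Proof.
move=> g0 mn; rewrite -!(big_mkord xpredT) (big_cat_nat _ mn) //= lerDl.
exact: sumr_ge0.
Qed.

Lemma ler_triple_sum f m n : (forall i j k, 0 <= f i j k) -> (m <= n)%N ->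
  triple_sum f m <= triple_sum f n.
Proof.
move=> f0 mn; rewrite /triple_sum.
apply: (@le_trans _ _ (\sum_(i < m) \sum_(j < n) \sum_(k < n) f i j k)).
  apply: ler_sum => i _.
  apply: (@le_trans _ _ (\sum_(j < m) \sum_(k < n) f i j k)).
    by apply: ler_sum => j _; exact: ler_sum_ord.
  apply: (@ler_sum_ord (fun j => \sum_(k < n) f i j k)) => // j.
  exact: sumr_ge0.
apply: (@ler_sum_ord (fun i => \sum_(j < n) \sum_(k < n) f i j k)) => // i.
by do 2 (apply: sumr_ge0 => ? _).
Qed.

(** The upper bound is monotonicity applied to the complement [1 - f]. *)
Lemma triple_sum_incr f m n : (forall i j k, 0 <= f i j k <= 1) -> (m <= n)%N ->
  0 <= triple_sum f n - triple_sum f m <= n%:R ^+ 3 - m%:R ^+ 3.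
Proof.
move=> f01 mn; rewrite subr_ge0 ler_triple_sum //=; last first.
  by move=> i j k; case/andP: (f01 i j k).
have E l : triple_sum (fun i j k => 1 - f i j k) l = l%:R ^+ 3 - triple_sum f l.
  rewrite /triple_sum.
  under eq_bigr => i _ do under eq_bigr => j _ do
    rewrite big_split /= sumr_const card_ord sumrN.
  under eq_bigr => i _ do rewrite big_split /= sumr_const card_ord sumrN.
  rewrite big_split /= sumr_const card_ord sumrN; congr (_ - _).
  by rewrite -!mulrnA -natrX; congr _%:R; rewrite !expnS expn0 muln1 mulnA.
have : triple_sum (fun i j k => 1 - f i j k) m <= triple_sum (fun i j k => 1 - f i j k) n.
  apply: ler_triple_sum mn => i j k; rewrite subr_ge0.
  by case/andP: (f01 i j k).
by rewrite !E; lra.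
Qed.

(** Numerator and denominator each grow by at most [n ^ 3 - m ^ 3 <= 3 n ^ 2 (n - m)], while the
    denominator is at least [2 / 9 n ^ 3]. Each growth thus costs [27 / 2 (n - m) / n], and the two
    together give 27. *)
Lemma triple_avg_incr (f u : nat -> nat -> nat -> R) m n :
  (forall i j k, 0 <= f i j k <= u i j k) -> (forall i j k, u i j k <= 1) ->
  (forall l, triple_sum u l = l%:R * (l%:R - 1) * (l%:R - 2)) ->
  (3 <= m)%N -> (m <= n)%N ->
  `|triple_sum f n / triple_sum u n - triple_sum f m / triple_sum u m| <=
  27 * (n%:R - m%:R) / n%:R.
Proof.
move=> fu u1 uE m3 mn.
have f01 i j k : 0 <= f i j k <= 1.
  by case/andP: (fu i j k) => -> /= /le_trans; apply; exact: u1.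
have u01 i j k : 0 <= u i j k <= 1.
  by rewrite u1 andbT; case/andP: (fu i j k); exact: le_trans.
have /andP[Sf0 Sf1] := triple_sum_incr f01 mn.
have /andP[Su0 Su1] := triple_sum_incr u01 mn.
have fm : 0 <= triple_sum f m <= triple_sum u m.
  apply/andP; split.
    apply: sumr_ge0 => i _; apply: sumr_ge0 => j _; apply: sumr_ge0 => k _.
    by case/andP: (f01 i j k).
  apply: ler_sum => i _; apply: ler_sum => j _; apply: ler_sum => k _.
  by case/andP: (fu i j k).
have M3 : 3 <= m%:R :> R by rewrite ler_nat.
have MN : m%:R <= n%:R :> R by rewrite ler_nat.
move: Sf0 Sf1 Su0 Su1 fm; move: (triple_sum f n) (triple_sum f m) (uE n) (uE m) => a b.
move: (triple_sum u n) (triple_sum u m) M3 MN; move: (n%:R : R) (m%:R : R).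
move=> N M D C M3 MN DE CE ab1 ab2 DC1 DC2 /andP[b0 bC].
have C0 : 0 < C by rewrite CE !mulr_gt0 //; lra.
have D0 : 0 < D by lra.
have N0 : 0 < N by lra.
have -> : a / D - b / C = (a - b) / D - b / C * ((D - C) / D) by field; rewrite !gt_eqF.
have key x : 0 <= x -> x <= N ^+ 3 - M ^+ 3 -> 0 <= x / D <= 27 * (N - M) / (2 * N) * 1.
  move=> x0 x1; rewrite divr_ge0 ?(ltW D0) //= mulr1 ler_pdivrMr // mulrAC.
  rewrite ler_pdivlMr; last by lra.
  have D1 : 2 / 9 * N ^+ 3 <= D.
    rewrite DE (_ : 2 / 9 * N ^+ 3 = N * (2 / 3 * N) * (1 / 3 * N)); last by field.
    by rewrite !ler_pM ?mulr_ge0 //; lra.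
  apply: (@le_trans _ _ (27 * (N - M) * (2 / 9 * N ^+ 3))); last first.
    by apply: ler_wpM2l D1; rewrite mulr_ge0 //; lra.
  apply: (@le_trans _ _ ((N - M) * (3 * N ^+ 2) * (2 * N))); last first.
    by rewrite le_eqVlt; apply/orP; left; apply/eqP; field.
  apply: ler_wpM2r; first by lra.
  apply: le_trans x1 _.
  rewrite (_ : N ^+ 3 - M ^+ 3 = (N - M) * (N ^+ 2 + N * M + M ^+ 2)); last by ring.
  by apply: ler_wpM2l; [lra | nra].
have /andP[x0 x1] := key _ ab1 ab2; have /andP[y0 y1] := key _ DC1 DC2.
have h0 : 0 <= b / C <= 1 by rewrite divr_ge0 ?(ltW C0) //= ler_pdivrMr // mul1r.
have -> : 27 * (N - M) / N = 27 * (N - M) / (2 * N) * 1 + 27 * (N - M) / (2 * N) * 1.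
  by field; rewrite gt_eqF.
rewrite ler_norml; case/andP: h0 => h0 h1.
have : 0 <= b / C * ((D - C) / D) <= (D - C) / D.
  by rewrite mulr_ge0 //= -[leRHS]mul1r ler_wpM2r.
by case/andP; lra.
Qed.

Lemma ex_sqrtn n : exists k, (k ^ 2 <= n < k.+1 ^ 2)%N.
Proof.
elim: n => [|n [k /andP[k1 k2]]]; first by exists 0%N.
have [h|h] := ltnP n.+1 (k.+1 ^ 2); first by exists k; rewrite h andbT ltnW.
by exists k.+1; rewrite h /=; nia.
Qed.

Lemma cvg_along_squares (U : nat -> R) (mu : R) :
  U (k.+2 ^ 2)%N @[k --> \oo] --> mu ->
  (forall m n, (3 <= m)%N -> (m <= n)%N -> `|U n - U m| <= 27 * (n%:R - m%:R) / n%:R) ->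
  U n @[n --> \oo] --> mu.
Proof.
move=> /cvgrPdist_le hU incr; apply/cvgrPdist_le => e e0.
have e2 : 0 < e / 2 by lra.
have [K1 _ hK1] := hU _ e2.
(* If [k ^ 2 <= n < (k + 1) ^ 2], then [n - k ^ 2 <= 2 k] and the variation is at most
   [27 * 2 k / n <= 54 / k]. *)
pose K2 := (Num.trunc (54 / (e / 2))).+1.
have K2e : 54 / (e / 2) < K2%:R by exact: truncnS_gt.
exists ((K1 + K2).+2 ^ 2)%N => // n /= Kn.
have [k /andP[k1 k2]] := ex_sqrtn n.
have Kk : ((K1 + K2).+2 <= k)%N by nia.
case: k k1 k2 Kk => [|[|k]] // k1 k2; rewrite !ltnS => Kk.
have h1 : `|mu - U (k.+2 ^ 2)%N| <= e / 2 by apply: hK1 => /=; lia.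
have n4 : (3 <= k.+2 ^ 2)%N by nia.
have h2 : `|U n - U (k.+2 ^ 2)%N| <= e / 2.
  apply: le_trans (incr _ _ n4 k1) _.
  have N0 : 0 < n%:R :> R by rewrite ltr0n; lia.
  have kR : K2%:R <= k.+2%:R :> R by rewrite ler_nat; lia.
  have n1 : k.+2%:R ^+ 2 <= n%:R :> R by rewrite -natrX ler_nat.
  have n2 : n%:R <= k.+2%:R ^+ 2 + 2 * k.+2%:R :> R.
    by rewrite -natrX -natrM -natrD ler_nat; nia.
  rewrite natrX ler_pdivrMr //; move: K2e; rewrite ltr_pdivrMr // => K2e.
  have K0 : 0 < K2%:R :> R by rewrite ltr0n.
  move: kR n1 n2 K2e; move: (k.+2%:R : R) (n%:R : R) (K2%:R : R) K0 => x N y y0 yx xN Nx h.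
  have : 54 * x <= x * (e / 2) * x.
    apply: ler_wpM2r; first by lra.
    by apply: le_trans (ltW h) _; apply: ler_wpM2r; lra.
  have : e / 2 * x ^+ 2 <= e / 2 * N by apply: ler_wpM2l => //; lra.
  rewrite expr2; lra.
rewrite (_ : mu - U n = (mu - U (k.+2 ^ 2)%N) - (U n - U (k.+2 ^ 2)%N)); last by ring.
by apply: le_trans (ler_normB _ _) _; lra.
Qed.

End Interpolation.

(** * Tightness and rates from local Lipschitz bounds *)

Section Rates.
Context (d : measure_display) (T : measurableType d) (R : realType).
Context (P : probability T R).

Local Notation "''E' f" := (Rintegral P setT f) (at level 10, f at level 8).

Lemma measurable_tail (f : T -> R) (M : R) : measurable_fun setT f ->
  measurable [set w | M < f w].
Proof.
move=> mf; rewrite -[X in measurable X]setTI.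
by have := mf measurableT `]M, +oo[%classic; rewrite preimage_itvoy; exact.
Qed.

(** Continuity from above: the events [k < f] decrease to the empty set since [f] takes real
    values. *)
Lemma tail_tight (f : T -> R) (eps : R) : measurable_fun setT f -> 0 < eps ->
  exists M, (P [set w | (M < f w)%R] <= eps%:E)%E.
Proof.
move=> mf e0; pose A (k : nat) := [set w | k%:R < f w].
have A0 : \bigcap_k A k = set0.
  apply/seteqP; split => // w /(_ (Num.trunc (f w)).+1 I).
  by rewrite /A /= ltNge ltW // truncnS_gt.
have cA : (P \o A) k @[k --> \oo] --> P set0.
  rewrite -A0; apply: nonincreasing_cvg_mu.
  - by rewrite (le_lt_trans (probability_le1 P _)) ?ltry //; exact: measurable_tail.
  - by move=> k; exact: measurable_tail.
  - by rewrite A0.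
  - move=> m n mn; apply/subsetPset => w /=; apply: le_lt_trans.
    by rewrite ler_nat.
have : P set0 \is a fin_num by rewrite measure0.
move: cA; rewrite measure0 => /fine_cvgP[_ /cvgrPdist_le /(_ _ e0)[N _ hN]] _.
have /= h := hN N (leqnn N).
exists N%:R; rewrite sub0r normrN in h.
rewrite -[P _]fineK ?lee_fin; last exact/fin_num_measure/measurable_tail.
exact: le_trans (ler_norm _) h.
Qed.

Lemma le_tail (f : T -> R) (M N : R) : measurable_fun setT f -> M <= N ->
  (P [set w | (N < f w)%R] <= P [set w | (M < f w)%R])%E.
Proof.
move=> mf MN; apply: le_measure; rewrite ?inE; [exact: measurable_tail..|].
by move=> w /=; exact: le_lt_trans.
Qed.

(** The indices below [n0] are absorbed one at a time, each by raising the bound. *)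
Lemma eventually_tight (f : nat -> T -> R) (eps : R) (n0 : nat) (M0 : R) :
  (forall n, measurable_fun setT (f n)) -> 0 < eps ->
  (forall n, (n0 <= n)%N -> (P [set w | (M0 < f n w)%R] <= eps%:E)%E) ->
  exists M, forall n, (P [set w | (M < f n w)%R] <= eps%:E)%E.
Proof.
move=> mf e0; elim: n0 M0 => [|n0 IHn0] M0 hM0; first by exists M0 => n; exact: hM0.
have [M1 hM1] := tail_tight (mf n0) e0.
apply: (IHn0 (Num.max M0 M1)) => n; rewrite leq_eqVlt => /predU1P[<-|n0n].
  by apply: le_trans (le_tail _ _) hM1 => //; rewrite le_max lexx orbT.
by apply: le_trans (le_tail _ _) (hM0 _ n0n) => //; rewrite le_max lexx.
Qed.

Section LocallyLipschitz.
Context (V : normedModType R) (Y : nat -> T -> V) (theta : V).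
Context (D : nat -> T -> R) (n0 : nat) (rho L : R).
Hypothesis rho0 : 0 < rho.
Hypothesis L0 : 0 < L.
Hypothesis D0 : forall n w, 0 <= D n w.
Hypothesis lipY : forall n w, (n0 <= n)%N -> D n w <= rho ->
  `|Y n w - theta| <= L * D n w.

Lemma locally_lipschitz_ae_cvg :
  {ae P, forall w, D n w @[n --> \oo] --> 0} ->
  {ae P, forall w, Y n w @[n --> \oo] --> theta}.
Proof.
apply: filterS => w /cvgrPdist_le hD; apply/cvgrPdist_le => e e0.
have m0 : 0 < Num.min rho (e / L) by rewrite lt_min rho0 divr_gt0.
have [N _ hN] := hD _ m0.
exists (maxn N n0) => // n /=; rewrite geq_max => /andP[Nn n0n].
have := hN n Nn; rewrite /= sub0r normrN ger0_norm // le_min => /andP[h1 h2].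
rewrite distrC; apply: le_trans (lipY n0n h1) _.
by rewrite mulrC -ler_pdivlMr.
Qed.

Lemma locally_lipschitz_rate (K : R) (r : nat -> R) :
  (forall n, measurable_fun setT (fun w => `|Y n w - theta|)) ->
  (forall n, bounded_measurable (D n)) ->
  (forall n, (n0 <= n)%N -> 0 < r n /\ 'E (fun w => D n w ^+ 2) <= K * r n ^+ 2) ->
  r n @[n --> \oo] --> 0 ->
  convergence_rate_at_least P Y theta r.
Proof.
move=> mY mD hr r_cvg eps e0.
have nE n w : `|(r n)^-1 *: (Y n w - theta)| = `|(r n)^-1| * `|Y n w - theta|.
  by rewrite normrZ.
have mf n : measurable_fun setT (fun w => `|(r n)^-1| * `|Y n w - theta|).
  by apply: measurable_funM => //; exact: measurable_cst.
have K0 : 0 <= K.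
  have [r0] := hr n0 (leqnn _).
  have : 0 <= 'E (fun w => D n0 w ^+ 2) by apply: Rintegral_ge0 => w _; exact: sqr_ge0.
  by move=> /le_trans h /h; rewrite pmulr_lge0 // exprn_gt0.
suff [n1 [M0 h]] : exists n1 M0, forall n, (n1 <= n)%N ->
    (P [set w | (M0 < `|(r n)^-1| * `|Y n w - theta|)%R] <= eps%:E)%E.
  have [M hM] := eventually_tight mf e0 h.
  by exists M => n; under eq_set do rewrite nE.
(* Chebyshev at level [r (x + 1)] leaves [K / (x + 1) ^ 2], at most [eps] because
   [(x + 1) ^ 2 >= x / 2 = K / eps]. The choice of [t] below ensures [r (x + 1) <= rho]. *)
pose x := 2 * K / eps.
have x0 : 0 <= x by rewrite /x divr_ge0 ?(ltW e0) //; lra.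
pose t := rho / (x + 1).
have t0 : 0 < t by rewrite divr_gt0 //; lra.
move: r_cvg => /cvgrPdist_le /(_ _ t0) [N _ hN].
exists (maxn N n0), (L * (x + 1)) => n; rewrite geq_max => /andP[Nn n0n].
have [r0 hE] := hr n n0n.
have rt : r n <= t.
  by have := hN n Nn; rewrite /= sub0r normrN; apply: le_trans; exact: ler_norm.
have mDn : measurable_fun setT (fun w => `|D n w|) by case: (bounded_measurable_norm (mD n)).
(* Outside [D <= rho] Chebyshev is applied at level [rho >= r (x + 1)]; inside,
   the Lipschitz bound turns the event into [r (x + 1) < D]. *)
apply: (@le_trans _ _ (P [set w | r n * (x + 1) < `|D n w|])).
  apply: le_measure; rewrite ?inE; [exact: measurable_tail..|].
  move=> w /= hw; rewrite ger0_norm //.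
  have [Dr|Dr] := leP (D n w) rho.
    move: hw; rewrite gtr0_norm ?invr_gt0 // => hw.
    have ri0 : 0 <= (r n)^-1 by rewrite invr_ge0 ltW.
    have := lt_le_trans hw (ler_wpM2l ri0 (lipY n0n Dr)).
    by rewrite mulrCA ltr_pM2l // [ltRHS]mulrC ltr_pdivlMr // [ltLHS]mulrC.
  by apply: le_lt_trans Dr; rewrite -ler_pdivlMr //; lra.
apply: le_trans (chebyshev_tail P (mD n) _) _; first by rewrite mulr_gt0 //; lra.
rewrite lee_fin ler_pdivrMr ?exprn_gt0 ?mulr_gt0 //; last by lra.
apply: le_trans hE _; rewrite [leLHS]mulrC.
have -> : eps * (r n * (x + 1)) ^+ 2 = r n ^+ 2 * (eps * (x + 1) ^+ 2) by ring.
apply: ler_wpM2l; first exact: sqr_ge0.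
have -> : K = eps * (x / 2) by rewrite /x; field; rewrite gt_eqF.
by apply: ler_wpM2l; [exact: ltW | nra].
Qed.

End LocallyLipschitz.

End Rates.

(** * Almost sure convergence of the empirical moments *)

Section TripleStatConvergence.
Context (d : measure_display) (T : measurableType d) (R : realType).
Context (P : probability T R) (Q : nat) (p : 'I_Q -> R) (alpha beta : R).
Context (Z : nat -> {RV P >-> Q.-tuple bool}) (X : nat -> nat -> {RV P >-> bool}).
Context (q0 : 'I_Q).
Hypothesis model : binary_affiliation_model p alpha beta Z X.
Context (E : nat -> nat -> nat -> seq (nat * nat)) (mu : R).
Hypothesis simpleE : forall i j k, uniq [:: i; j; k] -> simple_edges [:: i; j; k] (E i j k).
Hypothesis meanE : forall i j k z, uniq [:: i; j; k] ->
  label_avg p [:: i; j; k] (edge_weight alpha beta (E i j k)) z = mu.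

Lemma bounded_measurable_triple_stat n : bounded_measurable (triple_stat X E n).
Proof.
apply: bounded_measurableM; first exact: bounded_measurable_cst.
do 3 (apply: bounded_measurable_sum => ? _).
exact: bounded_measurable_edge_prod.
Qed.

(** Distinctness becomes a weight, so that numerator and denominator are both full triple sums, as
    the interpolation bound requires. *)
Let indic (i j k : nat) : R := (uniq [:: i; j; k])%:R.

Let triple_sum_indic l : triple_sum indic l = l%:R * (l%:R - 1) * (l%:R - 2).
Proof.
rewrite -[RHS]mulr1 -sum_triples /triple_sum; apply: eq_bigr => i _.
apply: eq_bigr => j _; rewrite [RHS]big_mkcond; apply: eq_bigr => k _.
rewrite (_ : uniq [:: i; j; k] = uniq [:: i : nat; j : nat; k : nat]) // /indic.
by case: uniq.
Qed.

Let triple_statE n w : triple_stat X E n w =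
  triple_sum (fun i j k => indic i j k * edge_prod X (E i j k) w) n / triple_sum indic n.
Proof.
rewrite triple_sum_indic mulrC; congr (_ * _); apply: eq_bigr => i _.
apply: eq_bigr => j _; rewrite [LHS]big_mkcond; apply: eq_bigr => k _.
rewrite (_ : uniq [:: i; j; k] = uniq [:: i : nat; j : nat; k : nat]) // /indic.
by case: uniq; rewrite ?mul1r ?mul0r.
Qed.

Lemma triple_stat_itv n w : 0 <= triple_stat X E n w <= 1.
Proof.
rewrite triple_statE; set a := triple_sum _ n; set b := triple_sum _ n.
have /andP[a0 ab] : 0 <= a <= b.
  apply/andP; split.
    apply: sumr_ge0 => i _; apply: sumr_ge0 => j _; apply: sumr_ge0 => k _.
    by rewrite mulr_ge0 ?ler0n //; case/andP: (edge_prod_itv X (E i j k) w).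
  apply: ler_sum => i _; apply: ler_sum => j _; apply: ler_sum => k _.
  rewrite -[leRHS]mulr1 ler_wpM2l ?ler0n //.
  by case/andP: (edge_prod_itv X (E i j k) w).
have b0 : 0 <= b by apply: le_trans ab.
(* For [n <= 2] the denominator vanishes and the quotient is 0 by convention. *)
rewrite divr_ge0 //=; have [->|bn0] := eqVneq b 0; first by rewrite invr0 mulr0.
by rewrite ler_pdivrMr ?mul1r // lt0r bn0.
Qed.

Lemma triple_stat_ae_cvg : {ae P, forall w, triple_stat X E n w @[n --> \oo] --> mu}.
Proof.
have : {ae P, forall w, triple_stat X E (k.+2 ^ 2)%N w - mu @[k --> \oo] --> 0}.
  have [c c0 hc] : exists2 c : R, 0 <= c & forall n, (3 <= n)%N ->
      Rintegral P setT (fun w => (triple_stat X E n w - mu) ^+ 2) <= c / n%:R.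
    exists (729 / 4); first by lra.
    by move=> n n3; exact: (expect_sqr_triple_stat q0 model simpleE meanE n3).
  (* A telescoping majorant of [c / (k + 2) ^ 2], with total at most [c]. Starting from the square
     of 2 keeps the number of nodes above 3. *)
  pose a (k : nat) : R := c * (k.+1%:R^-1 - k.+2%:R^-1).
  apply: (@ae_cvg0_summable_sqr _ _ _ P _ a c).
  - move=> k; apply: bounded_measurableB; first exact: bounded_measurable_triple_stat.
    exact: bounded_measurable_cst.
  - move=> k; have k4 : (3 <= k.+2 ^ 2)%N.
      by rewrite expnS expn1; apply: (@leq_trans (2 * 2)) => //; exact: leq_mul.
    apply: le_trans (hc _ k4) _; apply: ler_wpM2l => //.
    rewrite natrX -[k.+2]addn1 -[k.+1]addn1 !natrD.
    have k0 : 0 <= k%:R :> R by [].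
    rewrite (_ : (k%:R + 1)^-1 - (k%:R + 1 + 1)^-1 =
      ((k%:R + 1) * (k%:R + 1 + 1))^-1); last first.
      by field; rewrite !gt_eqF //; lra.
    rewrite lef_pV2 ?posrE ?exprn_gt0 ?mulr_gt0 //; try by lra.
  - move=> n; rewrite -mulr_sumr -[leRHS]mulr1; apply: ler_wpM2l => //.
    rewrite -(big_mkord xpredT (fun k => k.+1%:R^-1 - k.+2%:R^-1)).
    rewrite (telescope_sumr_eq (fun k => - k.+1%:R^-1)) //; last first.
      by move=> k _; rewrite opprK addrC.
    by rewrite opprK invr1 addrC lerBlDr lerDl invr_ge0.
apply: filterS => w hw; apply: cvg_along_squares.
  by rewrite -[mu]add0r; under eq_fun do rewrite -[triple_stat _ _ _ _](subrK mu);
    apply: cvgD => //; exact: cvg_cst.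
move=> m n m3 mn; rewrite !triple_statE; apply: triple_avg_incr => //.
- move=> i j k; have /andP[h0 h1] := edge_prod_itv X (E i j k) w.
  by rewrite mulr_ge0 ?ler0n //= -[leRHS]mulr1 ler_wpM2l ?ler0n.
- by move=> i j k; rewrite /indic; case: uniq.
Qed.

End TripleStatConvergence.

(** * Local inversion of the moment equations *)

Section PowerSums.
Context (R : realType) (Q : nat) (p : 'I_Q -> R).
Hypothesis p01 : forall q, 0 < p q < 1.
Hypothesis p1 : \sum_(q < Q) p q = 1.

Local Notation s2 := (\sum_(q < Q) p q ^+ 2).
Local Notation s3 := (\sum_(q < Q) p q ^+ 3).

Let p_ge0 q : 0 <= p q.
Proof. by case/andP: (p01 q) => /ltW. Qed.

Lemma power_sum3_ge0 : 0 <= s3.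
Proof. by apply: sumr_ge0 => q _; rewrite exprn_ge0. Qed.

Lemma sum_p_gt0 (h : 'I_Q -> R) : (forall q, 0 <= h q) -> (exists q, 0 < h q) ->
  0 < \sum_(q < Q) h q.
Proof.
by move=> h0 [q hq]; rewrite (bigD1 q) //= ltr_wpDr // sumr_ge0.
Qed.

Let inhabited : exists q : 'I_Q, true.
Proof.
case: (pickP (pred_of_simpl (@predT 'I_Q))) => [q _|h]; first by exists q.
by move: p1; rewrite big1 => [/eqP|q _]; [rewrite eq_sym oner_eq0 | have := h q].
Qed.

Lemma power_sum2_gt0 : 0 < s2.
Proof.
apply: sum_p_gt0 => [q|]; first by rewrite exprn_ge0.
by have [q _] := inhabited; exists q; rewrite exprn_gt0 //; case/andP: (p01 q).
Qed.

Lemma power_sum2_lt1 : s2 < 1.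
Proof.
rewrite -p1 -subr_gt0 -sumrB; apply: sum_p_gt0 => [q|].
  by case/andP: (p01 q) => h0 h1; nra.
by have [q _] := inhabited; exists q; case/andP: (p01 q) => h0 h1; nra.
Qed.

(** The difference is the variance of [p q] when [q] is drawn from [p]. It vanishes only if every
    [p q] equals [s2], hence [1 / Q]. *)
Lemma power_sum3_gt : (exists q, p q != Q%:R^-1) -> s2 ^+ 2 < s3.
Proof.
move=> [q pq].
have E : s3 - s2 ^+ 2 = \sum_(q < Q) p q * (p q - s2) ^+ 2.
  rewrite [RHS](eq_bigr (fun q => p q ^+ 3 + (- (2 * s2) * p q ^+ 2 + s2 ^+ 2 * p q))).
    by rewrite 2!big_split /= -!mulr_sumr p1; ring.
  by move=> r _; ring.
rewrite -subr_gt0 E; apply: sum_p_gt0 => [r|]; first by rewrite mulr_ge0 // sqr_ge0.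
have [/existsP[r pr]|/existsPn all_eq] := boolP [exists r, p r != s2].
  exists r; case/andP: (p01 r) => p0 _.
  by rewrite mulr_gt0 // lt0r sqr_ge0 sqrf_eq0 subr_eq0 pr.
have s2E r : p r = s2 by apply/eqP; rewrite -[_ == _]negbK all_eq.
move/eqP: pq; case; rewrite s2E; have := p1.
rewrite (eq_bigr (fun=> s2)) // sumr_const card_ord.
rewrite -[s2 *+ Q]mulr_natl => h.
have Q0 : Q%:R != 0 :> R by apply: contra_eq_neq h => ->; rewrite mul0r eq_sym oner_neq0.
by apply: (mulfI Q0); rewrite h mulfV.
Qed.

(** Cauchy-Schwarz gives [s3 ^ 2 <= s2 s4], with [s4] the sum of fourth powers, and [s4 <= s2 ^ 2]
    since [s4] collects the diagonal terms of that square. *)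
Lemma power_sum3_sqr_le : s3 ^+ 2 <= s2 ^+ 3.
Proof.
have s20 := power_sum2_gt0.
pose s4 := \sum_(q < Q) p q ^+ 4.
have s4le : s4 <= s2 ^+ 2.
  rewrite /s4 expr2 mulr_suml; apply: ler_sum => q _; rewrite (exprD _ 2 2).
  apply: ler_wpM2l; first by rewrite exprn_ge0.
  by rewrite [leRHS](bigD1 q) //= lerDl sumr_ge0 // => r _; rewrite exprn_ge0.
have : 0 <= \sum_(q < Q) p q ^+ 2 * (s2 * p q - s3) ^+ 2.
  by apply: sumr_ge0 => q _; rewrite mulr_ge0 ?sqr_ge0.
rewrite (eq_bigr (fun q => s2 ^+ 2 * p q ^+ 4 +
    (- (2 * s2 * s3) * p q ^+ 3 + s3 ^+ 2 * p q ^+ 2))); last by move=> q _; ring.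
rewrite 2!big_split /= -!mulr_sumr -/s4 => h.
have : 0 <= s2 * (s2 * s4 - s3 ^+ 2).
  by apply: le_trans h _; rewrite le_eqVlt; apply/orP; left; apply/eqP; ring.
rewrite pmulr_rge0 // subr_ge0 => /le_trans; apply.
by rewrite [leRHS]exprS ler_pM2l.
Qed.

(* [s3 <= s2 ^ (3/2)], and with [u = sqrt s2], [2 u ^ 3 - 3 u ^ 2 + 1 = (u - 1) ^ 2 (2 u + 1)]. *)
Lemma denominator_gt0 : 0 < 2 * s2 ^+ 3 - 3 * s3 * s2 + s3.
Proof.
have := power_sum2_gt0; have := power_sum2_lt1; have := power_sum3_ge0.
have := power_sum3_sqr_le; move: s2 s3 => x y yx y0 x1 x0.
have x3 : 0 < x ^+ 3 by rewrite exprn_gt0.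
have [h|h] := leP (3 * x) 1.
  have : 0 <= y * (1 - 3 * x) by rewrite mulr_ge0 // subr_ge0.
  by lra.
(* Square roots are avoided by squaring: a nonpositive denominator would give
   [4 x ^ 3 <= (3 x - 1) ^ 2], that is [(x - 1) ^ 2 (4 x - 1) <= 0], impossible for
   [1 / 3 < x < 1]. *)
rewrite -subr_gt0 subr0 ltNge; apply/negP => hle.
have x2 : 2 * x ^+ 3 <= y * (3 * x - 1) by lra.
have sq : (2 * x ^+ 3) ^+ 2 <= (y * (3 * x - 1)) ^+ 2.
  by apply: lerXn2r; rewrite ?nnegrE //; lra.
have : 2 ^+ 2 * (x ^+ 3) ^+ 2 <= x ^+ 3 * (3 * x - 1) ^+ 2.
  by rewrite -exprMn; apply: le_trans sq _; rewrite exprMn ler_wpM2r // sqr_ge0.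
rewrite [(x ^+ 3) ^+ 2]expr2 mulrCA ler_pM2l // => hx.
have : 0 < (x - 1) ^+ 2 * (4 * x - 1).
  rewrite mulr_gt0 //; last by lra.
  by rewrite lt0r sqr_ge0 sqrf_eq0 subr_eq0 lt_eqF.
by apply/negP; rewrite -leNgt; move: hx; lra.
Qed.

End PowerSums.

Lemma cbrtK (R : realType) (x : R) : cbrt x ^+ 3 = x.
Proof.
rewrite /cbrt exprMn -(@powR_mulrn _ (_ `^ _)) ?powR_ge0 // -powRrM mulVf // powRr1 //.
rewrite [in RHS](numEsg x); congr (_ * _).
by case: sgrP => _; rewrite ?expr0n ?expr1n // exprS sqrrN expr1n mulr1.
Qed.

Lemma measurable_cbrt (R : realType) : measurable_fun setT (@cbrt R).
Proof.
apply: measurable_funM.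
  rewrite (_ : Num.sg = fun x : R => if (0 < x)%R then 1 else if (x < 0)%R then -1 else 0);
    last by apply/funext => x; case: sgrP.
  apply: measurable_fun_ifT; [exact: measurable_fun_ltr|exact: measurable_cst|].
  by apply: measurable_fun_ifT; [exact: measurable_fun_ltr|exact: measurable_cst..].
apply: (measurableT_comp (measurable_powR _)); exact: normr_measurable.
Qed.

(** * Lipschitz bounds for the inverse maps *)

Section Estimators.
Context (R : realType).
Implicit Types x m a b c : R.

Lemma dist_sqr x m : 0 <= x <= 1 -> 0 <= m <= 1 -> `|x ^+ 2 - m ^+ 2| <= 2 * `|x - m|.
Proof.
move=> /andP[x0 x1] /andP[m0 m1]; rewrite subr_sqr mulrC normrM.
by apply: ler_wpM2r => //; rewrite ger0_norm; lra.
Qed.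

Lemma dist_cube x m : 0 <= x <= 1 -> 0 <= m <= 1 -> `|x ^+ 3 - m ^+ 3| <= 3 * `|x - m|.
Proof.
move=> /andP[x0 x1] /andP[m0 m1].
rewrite (_ : x ^+ 3 - m ^+ 3 = (x ^+ 2 + x * m + m ^+ 2) * (x - m)); last by ring.
by rewrite normrM; apply: ler_wpM2r => //; rewrite ger0_norm; nra.
Qed.

Lemma dist_mul x m x' m' : 0 <= x <= 1 -> 0 <= m' <= 1 ->
  `|x * x' - m * m'| <= `|x' - m'| + `|x - m|.
Proof.
move=> /andP[x0 x1] /andP[m0 m1].
rewrite (_ : x * x' - m * m' = x * (x' - m') + m' * (x - m)); last by ring.
apply: le_trans (ler_normD _ _) _; rewrite !normrM !(ger0_norm x0) (ger0_norm m0).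
by rewrite lerD // -[leRHS]mul1r ler_wpM2r.
Qed.

Section Unequal.
Context (x1 x2 x3 m1 m2 m3 c1 c2 c3 K b : R).
Hypotheses (hx1 : 0 <= x1 <= 1) (hx2 : 0 <= x2 <= 1).
Hypotheses (hm1 : 0 <= m1 <= 1) (hm2 : 0 <= m2 <= 1).
Hypotheses (K0 : 0 < K) (A0 : m1 ^+ 2 - m2 != 0) (b01 : 0 < b < 1).
Hypothesis fixb : c1 * m1 ^+ 3 + c2 * m2 * m1 + c3 * m3 = b * ((m1 ^+ 2 - m2) * K).

Local Notation D := (`|x1 - m1| + `|x2 - m2| + `|x3 - m3|).
Local Notation A := (`|m1 ^+ 2 - m2|).

Let x1D : `|x1 - m1| <= D. Proof. by rewrite -addrA lerDl addr_ge0. Qed.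
Let x2D : `|x2 - m2| <= D. Proof. by rewrite addrAC lerDr addr_ge0. Qed.
Let x3D : `|x3 - m3| <= D. Proof. by rewrite lerDr addr_ge0. Qed.

Lemma denominator_dist : `|(x1 ^+ 2 - x2) - (m1 ^+ 2 - m2)| <= 2 * D.
Proof.
rewrite (_ : _ - _ = (x1 ^+ 2 - m1 ^+ 2) - (x2 - m2)); last by ring.
apply: le_trans (ler_normB _ _) _; have := dist_sqr hx1 hm1.
by have := normr_ge0 (x2 - m2); have := normr_ge0 (x3 - m3); lra.
Qed.

(** The denominator moves by at most [2 D], so within radius [A / 4] it keeps half of its limiting
    size. *)
Lemma denominator_ge : D <= A / 4 -> A / 2 <= `|x1 ^+ 2 - x2|.
Proof.
move=> DA; have := denominator_dist.
have := ler_normB (x1 ^+ 2 - x2) ((x1 ^+ 2 - x2) - (m1 ^+ 2 - m2)).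
by rewrite subKr; lra.
Qed.

(** By [fixb], numerator minus [b] times denominator vanishes at the true moments. Its increments
    are bounded by [3 D] for the cube, [2 D] for the product, [D] for the third moment and [2 K D]
    for the denominator; the final factor 2 comes from [denominator_ge]. *)
Lemma ratio_lipschitz : D <= A / 4 ->
  `|(c1 * x1 ^+ 3 + c2 * x2 * x1 + c3 * x3) / ((x1 ^+ 2 - x2) * K) - b| <=
  (3 * `|c1| + 2 * `|c2| + `|c3| + 2 * K) * 2 / (A * K) * D.
Proof.
move=> DA; have hd := denominator_ge DA.
have Ap : 0 < A by rewrite normr_gt0.
have d0 : x1 ^+ 2 - x2 != 0 by rewrite -normr_gt0; apply: lt_le_trans hd; lra.
rewrite (_ : _ / _ - b = (c1 * (x1 ^+ 3 - m1 ^+ 3) + c2 * (x2 * x1 - m2 * m1) + c3 * (x3 - m3)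
   - b * K * ((x1 ^+ 2 - x2) - (m1 ^+ 2 - m2))) / ((x1 ^+ 2 - x2) * K)); last first.
  have dK := mulf_neq0 d0 (lt0r_neq0 K0).
  by apply: (mulIf dK); rewrite mulrBl !divfK //; move: fixb; lra.
rewrite normf_div [X in _ / X]normrM (gtr0_norm K0) ler_pdivrMr ?mulr_gt0 ?normr_gt0 //.
set S := (3 * `|c1| + _ + _ + _).
apply: (@le_trans _ _ (S * D)).
  case/andP: b01 => b0 b1.
  have h1 : `|c1 * (x1 ^+ 3 - m1 ^+ 3)| <= `|c1| * (3 * D).
    rewrite normrM; apply: ler_wpM2l => //.
    by apply: le_trans (dist_cube hx1 hm1) _; have := x1D; lra.
  have h2 : `|c2 * (x2 * x1 - m2 * m1)| <= `|c2| * (2 * D).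
    rewrite normrM; apply: ler_wpM2l => //.
    by apply: le_trans (dist_mul _ _ hx2 hm1) _; have := x1D; have := x2D; lra.
  have h3 : `|c3 * (x3 - m3)| <= `|c3| * D.
    by rewrite normrM; apply: ler_wpM2l => //; exact: x3D.
  have h4 : `|b * K * ((x1 ^+ 2 - x2) - (m1 ^+ 2 - m2))| <= K * (2 * D).
    rewrite normrM normrM (gtr0_norm K0) (gtr0_norm b0); apply: ler_pM => //.
    - by rewrite mulr_ge0 // ltW.
    - by rewrite ler_piMl // ltW.
    - exact: denominator_dist.
  have -> : S * D = `|c1| * (3 * D) + `|c2| * (2 * D) + `|c3| * D + K * (2 * D).
    by rewrite /S; ring.
  apply: le_trans (ler_normB _ _) _; apply: lerD h4.
  apply: le_trans (ler_normD _ _) _; apply: lerD h3.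
  exact: le_trans (ler_normD _ _) (lerD h1 h2).
rewrite (_ : S * 2 / (A * K) * D * _ = S * D * (`|x1 ^+ 2 - x2| / (A / 2))); last first.
  by field; rewrite !lt0r_neq0.
have S0 : 0 <= S by rewrite /S !addr_ge0 ?mulr_ge0 // ltW.
rewrite -[leLHS]mulr1; apply: ler_wpM2l.
  by apply: mulr_ge0 S0 _; rewrite !addr_ge0.
by rewrite ler_pdivlMr ?mul1r //; lra.
Qed.

End Unequal.

(** With [u] the cube root of [x], the cofactor [u ^ 2 + u t + t ^ 2] of [u - t] is at least
    [3 / 4 t ^ 2] for every [u], so the bound is global in [x]. *)
Lemma cbrt_lipschitz (x t : R) : t != 0 ->
  `|cbrt x - t| <= 4 / (3 * t ^+ 2) * `|x - t ^+ 3|.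
Proof.
move=> t0; have T0 : 0 < t ^+ 2 by rewrite lt0r sqr_ge0 sqrf_eq0 t0.
rewrite -{2}(cbrtK x); set u := cbrt x.
rewrite (_ : u ^+ 3 - t ^+ 3 = (u ^+ 2 + u * t + t ^+ 2) * (u - t)); last by ring.
rewrite normrM mulrA -[leLHS]mul1r; apply: ler_wpM2r => //.
have h : 3 / 4 * t ^+ 2 <= u ^+ 2 + u * t + t ^+ 2.
  rewrite -subr_ge0 (_ : _ - _ = (u + t / 2) ^+ 2); first exact: sqr_ge0.
  by field.
rewrite ger0_norm; last by apply: le_trans h; rewrite mulr_ge0 // ltW.
rewrite mulrAC ler_pdivlMr; last by rewrite mulr_gt0.
by rewrite mul1r; lra.
Qed.

End Estimators.

(** * The estimators *)

Section EmpiricalMoments.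
Context (d : measure_display) (T : measurableType d) (R : realType).
Context (P : probability T R) (X : nat -> nat -> {RV P >-> bool}).

(** Each ordered edge extends to [n - 2] triples, a factor that must be nonzero to cancel. *)
Lemma emp_m1E n w : (3 <= n)%N -> emp_m1 X n w = triple_stat X single_edge n w.
Proof.
move=> n3; have n2 : n%:R - 2 != 0 :> R.
  by rewrite subr_eq0 -[2]/(2%:R) eqr_nat; apply/eqP => h; rewrite h in n3.
rewrite /emp_m1 /triple_stat [in RHS]invfM -[RHS]mulrA; congr (_ * _).
rewrite mulr_sumr; apply: eq_bigr => i _; rewrite mulr_sumr [LHS]big_mkcond /=.
apply: eq_bigr => j _; rewrite /edge_prod /single_edge.
under eq_bigr => k _ do rewrite big_cons big_nil mulr1 /=.
rewrite sum_third inE andbT; case: eqVneq => _ /=; first by rewrite mul0r mulr0.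
by rewrite mulKf.
Qed.

Lemma emp_m2E n w : emp_m2 X n w = triple_stat X two_star n w.
Proof.
congr (_ * _); apply: eq_bigr => i _; apply: eq_bigr => j _; apply: eq_bigr => k _.
by rewrite /edge_prod !big_cons big_nil mulr1.
Qed.

Lemma emp_m3E n w : emp_m3 X n w = triple_stat X triangle n w.
Proof.
congr (_ * _); apply: eq_bigr => i _; apply: eq_bigr => j _; apply: eq_bigr => k _.
by rewrite /edge_prod !big_cons big_nil mulr1 mulrA.
Qed.

(** Proved directly, to include the ranks below 3 where [emp_m1E] does not apply. *)
Lemma measurable_emp_m1 n : measurable_fun setT (emp_m1 X n).
Proof.
suff [] : bounded_measurable (emp_m1 X n) by [].
apply: bounded_measurableM; first exact: bounded_measurable_cst.
do 2 (apply: bounded_measurable_sum => ? _); exact: bounded_measurable_edge.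
Qed.

Lemma measurable_emp_m3 n : measurable_fun setT (emp_m3 X n).
Proof.
rewrite (_ : emp_m3 X n = triple_stat X triangle n); last exact/funext/emp_m3E.
by case: (bounded_measurable_triple_stat X triangle n).
Qed.

End EmpiricalMoments.

Lemma expect_sqrD_le (d : measure_display) (T : measurableType d) (R : realType)
    (P : probability T R) (f g : T -> R) :
  bounded_measurable f -> bounded_measurable g ->
  Rintegral P setT (fun w => (f w + g w) ^+ 2) <=
  2 * (Rintegral P setT (fun w => f w ^+ 2) + Rintegral P setT (fun w => g w ^+ 2)).
Proof.
move=> hf hg; have hf2 := bounded_measurableX 2 hf; have hg2 := bounded_measurableX 2 hg.
have hD := bounded_measurableD hf2 hg2.
rewrite -(expectD P hf2 hg2) -(expectZ P 2 hD); apply: le_expect => [||w].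
- by apply: bounded_measurableX; exact: bounded_measurableD.
- by apply: bounded_measurableM => //; exact: bounded_measurable_cst.
- by have := sqr_ge0 (f w - g w); lra.
Qed.

Section PairEstimator.
Context (R : realType).

Lemma pair_dist_le (a b x y : R) : `|(a, b) - (x, y)| <= `|a - x| + `|b - y|.
Proof. by rewrite prod_normE ge_max lerDl lerDr !normr_ge0. Qed.

Lemma measurable_pair_dist (d : measure_display) (T : measurableType d)
    (f g : T -> R) (x y : R) : measurable_fun setT f -> measurable_fun setT g ->
  measurable_fun setT (fun w => `|(f w, g w) - (x, y)|).
Proof.
move=> mf mg; under eq_fun do rewrite prod_normE /=.
apply: measurable_maxr; apply: measurableT_comp => //;
  by apply: measurable_funB => //; exact: measurable_cst.
Qed.

Lemma cvg_inv_nat : (1 / n%:R : R) @[n --> \oo] --> 0.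
Proof.
apply/cvgrPdist_le => e e0; exists (Num.trunc e^-1).+1 => // n /= hn.
have n0 : 0 < n%:R :> R by rewrite ltr0n; case: n hn.
rewrite sub0r normrN ger0_norm ?divr_ge0 ?ler0n // div1r invf_ple ?posrE //.
by apply: le_trans (ltW (truncnS_gt _)) _; rewrite ler_nat.
Qed.

Lemma cvg_inv_sqrt_nat : (1 / Num.sqrt n%:R : R) @[n --> \oo] --> 0.
Proof.
apply/cvgrPdist_le => e e0; exists (Num.trunc (e^-1 ^+ 2)).+1 => // n /= hn.
have n0 : 0 < n%:R :> R by rewrite ltr0n; case: n hn.
have s0 : 0 < Num.sqrt n%:R :> R by rewrite sqrtr_gt0.
rewrite sub0r normrN ger0_norm ?divr_ge0 ?sqrtr_ge0 // div1r invf_ple ?posrE //.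
have e10 : 0 <= e^-1 by rewrite invr_ge0 ltW.
rewrite -(ger0_norm e10) -sqrtr_sqr ler_sqrt //.
by apply: le_trans (ltW (truncnS_gt _)) _; rewrite ler_nat.
Qed.

End PairEstimator.

Section Consistency.
Context (d : measure_display) (T : measurableType d) (R : realType).
Context (P : probability T R) (Q : nat) (p : 'I_Q -> R) (alpha beta : R).
Context (Z : nat -> {RV P >-> Q.-tuple bool}) (X : nat -> nat -> {RV P >-> bool}).
Hypothesis Q2 : (2 <= Q)%N.
Hypothesis p01 : forall q, 0 < p q < 1.
Hypothesis p1 : \sum_(q < Q) p q = 1.
Hypothesis beta01 : 0 < beta < 1.
Hypothesis ab : alpha != beta.
Hypothesis model : binary_affiliation_model p alpha beta Z X.

Local Notation s2 := (\sum_(q < Q) p q ^+ 2).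
Local Notation s3 := (\sum_(q < Q) p q ^+ 3).
Local Notation delta := (alpha - beta).
Local Notation mu1 := (beta + delta * s2).
Local Notation mu2 := (beta ^+ 2 + 2 * beta * delta * s2 + delta ^+ 2 * s3).
Local Notation mu3 :=
  (beta ^+ 3 + 3 * beta ^+ 2 * delta * s2 + 3 * beta * delta ^+ 2 * s3 + delta ^+ 3 * s3).
Local Notation U1 := (triple_stat X single_edge).
Local Notation U2 := (triple_stat X two_star).
Local Notation U3 := (triple_stat X triangle).

Let q0 : 'I_Q := Ordinal (ltnW Q2).

Let mean1 i j k z (u : uniq [:: i; j; k]) :=
  @label_avg_single_edge R Q p alpha beta p1 i j k z u.
Let mean2 i j k z (u : uniq [:: i; j; k]) :=
  @label_avg_two_star R Q p alpha beta p1 i j k z u.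
Let mean3 i j k z (u : uniq [:: i; j; k]) :=
  @label_avg_triangle R Q p alpha beta p1 i j k z u.

Let dev E (mu : R) n w := `|triple_stat X E n w - mu|.

Let bounded_measurable_dev E mu n : bounded_measurable (dev E mu n).
Proof.
apply: bounded_measurable_norm; apply: bounded_measurableB.
  exact: bounded_measurable_triple_stat.
exact: bounded_measurable_cst.
Qed.

Let expect_dev_sqr E mu n : Rintegral P setT (fun w => dev E mu n w ^+ 2) =
  Rintegral P setT (fun w => (triple_stat X E n w - mu) ^+ 2).
Proof. by apply: eq_Rintegral => w _; rewrite /dev real_normK // num_real. Qed.

Let dev_cvg0 E mu w :
  triple_stat X E n w @[n --> \oo] --> mu -> dev E mu n w @[n --> \oo] --> 0.
Proof.
move=> h; rewrite /dev -(normr0 R) -(subrr mu).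
by apply: cvg_norm; apply: cvgB h _; exact: cvg_cst.
Qed.

Lemma unequal_proportions_rate (alpha_hat beta_hat : nat -> {RV P >-> R}) :
  (exists q, p q != Q%:R^-1) ->
  (forall n w, let den := (emp_m1 X n w ^+ 2 - emp_m2 X n w) *
                   (2 * s2 ^+ 3 - 3 * s3 * s2 + s3) in
    den != 0 ->
    beta_hat n w =
      ((s3 - s2 * s3) * emp_m1 X n w ^+ 3
       + (s2 ^+ 3 - s3) * emp_m2 X n w * emp_m1 X n w
       + (s3 * s2 - s2 ^+ 3) * emp_m3 X n w) / den /\
    alpha_hat n w = (emp_m1 X n w + (s2 - 1) * beta_hat n w) / s2) ->
  {ae P, forall w, (alpha_hat n w, beta_hat n w) @[n --> \oo] --> (alpha, beta)} /\
  convergence_rate_at_least P (fun n w => (alpha_hat n w, beta_hat n w)) (alpha, beta)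
    (fun n => 1 / Num.sqrt n%:R).
Proof.
move=> pne hest.
have s20 := power_sum2_gt0 p01 p1; have s21 := power_sum2_lt1 p01 p1.
have s23 := power_sum3_gt p01 p1 pne; have K0 := denominator_gt0 p01 p1.
set K := 2 * s2 ^+ 3 - 3 * s3 * s2 + s3 in K0 hest *.
pose A := `|mu1 ^+ 2 - mu2|.
have A0 : mu1 ^+ 2 - mu2 != 0.
  rewrite (_ : _ - _ = delta ^+ 2 * (s2 ^+ 2 - s3)); last by ring.
  by rewrite mulf_neq0 ?expf_neq0 ?subr_eq0 // lt_eqF.
have Ap : 0 < A by rewrite normr_gt0.
pose D n w := dev single_edge mu1 n w + dev two_star mu2 n w + dev triangle mu3 n w.
have bD n : bounded_measurable (D n) by do 2 (apply: bounded_measurableD => //).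
have D0 n w : 0 <= D n w by rewrite /D /dev !addr_ge0.
pose Lb := (3 * `|s3 - s2 * s3| + 2 * `|s2 ^+ 3 - s3| + `|s3 * s2 - s2 ^+ 3| + 2 * K) * 2
  / (A * K).
have Lb0 : 0 <= Lb.
  apply: divr_ge0; last by rewrite mulr_ge0 // ltW.
  by rewrite mulr_ge0 // !addr_ge0 ?mulr_ge0 // ltW.
pose L := Lb + (1 + `|s2 - 1| * Lb) / s2.
have L0 : 0 < L.
  by apply: (ltr_wpDl Lb0); rewrite divr_gt0 // ltr_pwDl // mulr_ge0.
have m1_itv := mean_itv q0 model simple_single_edge mean1.
have m2_itv := mean_itv q0 model simple_two_star mean2.
have lipY n w : (3 <= n)%N -> D n w <= A / 4 ->
    `|(alpha_hat n w, beta_hat n w) - (alpha, beta)| <= L * D n w.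
  move=> n3 DA; have := hest n w; rewrite emp_m1E // emp_m2E emp_m3E.
  have x1_itv := triple_stat_itv X single_edge n w.
  have x2_itv := triple_stat_itv X two_star n w.
  (* Within the radius [A / 4] the arbitrary values of the estimators never occur. *)
  have den0 : (U1 n w ^+ 2 - U2 n w) * K != 0.
    rewrite mulf_neq0 ?(lt0r_neq0 K0) // -normr_gt0.
    have := denominator_ge x1_itv m1_itv DA; rewrite -/A.
    by apply: lt_le_trans; rewrite divr_gt0.
  move=> /(_ den0)[bE aE].
  have hb : `|beta_hat n w - beta| <= Lb * D n w.
    rewrite bE; apply: ratio_lipschitz => //; rewrite /K; ring.
  have ha : `|alpha_hat n w - alpha| <= (1 + `|s2 - 1| * Lb) / s2 * D n w.
    rewrite aE (_ : _ - alpha =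
      ((U1 n w - mu1) + (s2 - 1) * (beta_hat n w - beta)) / s2); last first.
      by field; rewrite gt_eqF.
    rewrite normrM normfV (gtr0_norm s20) [leRHS]mulrAC.
    rewrite ler_pM2r ?invr_gt0 // [leRHS]mulrDl mul1r.
    apply: le_trans (ler_normD _ _) _; apply: lerD.
      by rewrite /D /dev -[leRHS]addrA lerDl addr_ge0.
    by rewrite normrM -mulrA; apply: ler_wpM2l.
  apply: le_trans (pair_dist_le _ _ _ _) _; rewrite /L [leRHS]mulrDl addrC.
  exact: lerD.
split.
  apply: (locally_lipschitz_ae_cvg (D := D) (n0 := 3) (rho := A / 4) (L := L)) => //.
    by rewrite divr_gt0.
  have c1 := triple_stat_ae_cvg q0 model simple_single_edge mean1.
  have c2 := triple_stat_ae_cvg q0 model simple_two_star mean2.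
  have c3 := triple_stat_ae_cvg q0 model simple_triangle mean3.
  move: c1 c2 c3; apply: filterS3 => w h1 h2 h3.
  rewrite -[0 : R]addr0 -{1}[0 : R]addr0.
  by apply: cvgD; [apply: cvgD|]; exact: dev_cvg0.
have [c c0 hc] : exists2 c : R, 0 <= c & forall n, (3 <= n)%N ->
    [/\ Rintegral P setT (fun w => (U1 n w - mu1) ^+ 2) <= c / n%:R,
        Rintegral P setT (fun w => (U2 n w - mu2) ^+ 2) <= c / n%:R &
        Rintegral P setT (fun w => (U3 n w - mu3) ^+ 2) <= c / n%:R].
  exists (729 / 4); first by lra.
  move=> n n3; split.
  - exact: (expect_sqr_triple_stat q0 model simple_single_edge mean1 n3).
  - exact: (expect_sqr_triple_stat q0 model simple_two_star mean2 n3).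
  - exact: (expect_sqr_triple_stat q0 model simple_triangle mean3 n3).

(* Two uses of [expect_sqrD_le] on three deviations give [2 (2 (c + c) + c) = 10 c]. *)
apply: (@locally_lipschitz_rate _ _ _ P _ _ _ D 3 (A / 4) L _ L0 D0 lipY (10 * c)) => //.
- by rewrite divr_gt0.
- by move=> n; exact: measurable_pair_dist.
- move=> n n3; have n0 : 0 < n%:R :> R by rewrite ltr0n; exact: leq_trans n3.
  split; first by rewrite div1r invr_gt0 sqrtr_gt0.
  rewrite expr_div_n expr1n sqr_sqrtr ?(ltW n0) // mul1r.
  have [h1 h2 h3] := hc n n3.
  have hD := expect_sqrD_le P (bounded_measurableD (bounded_measurable_dev single_edge mu1 n)
    (bounded_measurable_dev two_star mu2 n)) (bounded_measurable_dev triangle mu3 n).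
  have hD' := expect_sqrD_le P (bounded_measurable_dev single_edge mu1 n)
    (bounded_measurable_dev two_star mu2 n).
  rewrite !expect_dev_sqr in hD hD'.
  apply: le_trans hD _; move: h1 h2 h3 hD'; lra.
- exact: cvg_inv_sqrt_nat.
Qed.

Lemma equal_proportions_rate : (forall q, p q = Q%:R^-1) ->
  let beta_hat := fun (n : nat) (w : T) =>
    emp_m1 X n w + cbrt ((emp_m1 X n w ^+ 3 - emp_m3 X n w) / (Q%:R - 1)) in
  let alpha_hat := fun (n : nat) (w : T) =>
    Q%:R * emp_m1 X n w + (1 - Q%:R) * beta_hat n w in
  {ae P, forall w, (alpha_hat n w, beta_hat n w) @[n --> \oo] --> (alpha, beta)} /\
  convergence_rate_at_least P (fun n w => (alpha_hat n w, beta_hat n w)) (alpha, beta)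
    (fun n => 1 / n%:R).
Proof.
move=> peq beta_hat alpha_hat.
have Q0 : (0 < Q)%N := ltnW Q2.
have QR : 2 <= Q%:R :> R by rewrite ler_nat.
have s2E := sum_p2_eq Q0 peq; have s3E := sum_p3_eq Q0 peq.
(* The limit of the cube root, equal to [beta - mu1]. *)
pose t := - (delta / Q%:R).
have t0 : t != 0.
  by rewrite oppr_eq0 mulf_neq0 ?subr_eq0 // invr_neq0 // gt_eqF //; lra.
have betaE : beta = mu1 + t by rewrite s2E /t; ring.
have t3E : t ^+ 3 = (mu1 ^+ 3 - mu3) / (Q%:R - 1).
  rewrite s2E s3E /t; field; apply/andP; split; rewrite gt_eqF //; lra.
pose D n w := dev single_edge mu1 n w + dev triangle mu3 n w.
have bD n : bounded_measurable (D n) by apply: bounded_measurableD.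
have D0 n w : 0 <= D n w by rewrite /D /dev !addr_ge0.
pose Lb := 1 + 4 / (3 * t ^+ 2) * 3.
have T0 : 0 < t ^+ 2 by rewrite lt0r sqr_ge0 sqrf_eq0 t0.
have Lc0 : 0 < 4 / (3 * t ^+ 2) by rewrite divr_gt0 // mulr_gt0.
have Lb0 : 0 < Lb by rewrite /Lb; lra.
pose L := Lb + (Q%:R + (Q%:R - 1) * Lb).
have L0 : 0 < L.
  have : 0 <= (Q%:R - 1) * Lb by rewrite mulr_ge0 //; lra.
  by rewrite /L; lra.
have m1_itv := mean_itv q0 model simple_single_edge mean1.
have lipY n w : (3 <= n)%N -> D n w <= 1 ->
    `|(alpha_hat n w, beta_hat n w) - (alpha, beta)| <= L * D n w.
  move=> n3 _.
  have x1_itv := triple_stat_itv X single_edge n w.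
  have d1 : `|U1 n w - mu1| <= D n w by rewrite /D /dev lerDl.
  have d3 : `|U3 n w - mu3| <= D n w by rewrite /D /dev lerDr.
  have hb : `|beta_hat n w - beta| <= Lb * D n w.
    rewrite /beta_hat emp_m1E // emp_m3E {1}betaE opprD addrACA.
    set y := (_ / _); apply: le_trans (ler_normD _ _) _.
    rewrite /Lb [leRHS]mulrDl mul1r; apply: lerD d1 _.
    apply: le_trans (cbrt_lipschitz _ t0) _; rewrite -[leRHS]mulrA.
    apply: ler_wpM2l; first exact: ltW.
    rewrite t3E /y -mulrBl normrM normfV ler_pdivrMr; last by rewrite normr_gt0 gt_eqF //; lra.
    rewrite (_ : _ - _ = (U1 n w ^+ 3 - mu1 ^+ 3) - (U3 n w - mu3)); last by ring.
    apply: le_trans (ler_normB _ _) _; have h := dist_cube x1_itv m1_itv.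
    have hQ : 3 * D n w <= 3 * D n w * `|Q%:R - 1|.
      rewrite -[leLHS]mulr1; apply: ler_wpM2l; first by rewrite mulr_ge0.
      by rewrite ger0_norm; lra.
    apply: le_trans _ hQ; rewrite /D [leRHS]mulrDr; apply: lerD; first exact: h.
    by rewrite /dev; have := normr_ge0 (U3 n w - mu3); lra.
  have ha : `|alpha_hat n w - alpha| <= (Q%:R + (Q%:R - 1) * Lb) * D n w.
    rewrite /alpha_hat emp_m1E //.
    rewrite (_ : _ - alpha =
      Q%:R * (U1 n w - mu1) - (Q%:R - 1) * (beta_hat n w - beta)); last first.
      by rewrite s2E; field; rewrite gt_eqF //; lra.
    apply: le_trans (ler_normB _ _) _; rewrite !normrM [leRHS]mulrDl; apply: lerD.
      by rewrite ger0_norm; [apply: ler_wpM2l => //; lra | lra].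
    by rewrite -mulrA ger0_norm; [apply: ler_wpM2l => //; lra | lra].
  apply: le_trans (pair_dist_le _ _ _ _) _; rewrite /L [leRHS]mulrDl addrC.
  exact: lerD.
split.
  apply: (locally_lipschitz_ae_cvg (D := D) (n0 := 3) (rho := 1) (L := L)) => //.
  have c1 := triple_stat_ae_cvg q0 model simple_single_edge mean1.
  have c3 := triple_stat_ae_cvg q0 model simple_triangle mean3.
  move: c1 c3; apply: filterS2 => w h1 h3; rewrite -[0 : R]addr0.
  by apply: cvgD; exact: dev_cvg0.
have [c c0 hc] : exists2 c : R, 0 <= c & forall n, (3 <= n)%N ->
    Rintegral P setT (fun w => (U1 n w - mu1) ^+ 2) <= c / n%:R ^+ 2 /\
    Rintegral P setT (fun w => (U3 n w - mu3) ^+ 2) <= c / n%:R ^+ 2.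
  exists (2187 / 4); first by lra.
  move=> n n3; split.
  - apply: (expect_sqr_degenerate_triple_stat q0 model simple_single_edge mean1 n3).
    by move=> i j k z u; exact: label_avg_single_edge_eq.
  - apply: (expect_sqr_degenerate_triple_stat q0 model simple_triangle mean3 n3).
    by move=> i j k z u; rewrite label_avg_triangle1 // label_avg_triangle2 //
      label_avg_triangle3 //
      !triangle_given_eq.
(* Here only two deviations are added, whence [2 (c + c) = 4 c]. *)
apply: (@locally_lipschitz_rate _ _ _ P _ _ _ D 3 1 L ltr01 L0 D0 lipY (4 * c)) => //.
- move=> n; have mb : measurable_fun setT (beta_hat n).
    apply: measurable_funD; first exact: measurable_emp_m1.
    apply: (measurableT_comp (@measurable_cbrt R)); apply: measurable_funM => //.
    apply: measurable_funB; last exact: measurable_emp_m3.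
    by apply: measurable_funX; exact: measurable_emp_m1.
  apply: measurable_pair_dist => //; apply: measurable_funD; apply: measurable_funM => //.
  exact: measurable_emp_m1.
- move=> n n3; have n0 : 0 < n%:R :> R by rewrite ltr0n; exact: leq_trans n3.
  split; first by rewrite div1r invr_gt0.
  rewrite expr_div_n expr1n mul1r; have [h1 h3] := hc n n3.
  have hD := expect_sqrD_le P (bounded_measurable_dev single_edge mu1 n)
    (bounded_measurable_dev triangle mu3 n).
  rewrite !expect_dev_sqr in hD.
  apply: le_trans hD _; move: h1 h3; lra.
- exact: cvg_inv_nat.
Qed.

End Consistency.

Theorem theorem3 (d : measure_display) (T : measurableType d) (R : realType)
    (P : probability T R) (Q : nat) (p : 'I_Q -> R) (alpha beta : R)
    (Z : nat -> {RV P >-> Q.-tuple bool})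
    (X : nat -> nat -> {RV P >-> bool})
    (hQ : (2 <= Q)%N)
    (hp : forall q, 0 < p q < 1)
    (hp1 : \sum_(q < Q) p q = 1)
    (halpha : 0 < alpha < 1)
    (hbeta : 0 < beta < 1)
    (hab : alpha != beta)
    (hmodel : binary_affiliation_model p alpha beta Z X) :
  let s2 := \sum_(q < Q) p q ^+ 2 in
  let s3 := \sum_(q < Q) p q ^+ 3 in
  let m1 := emp_m1 X in
  let m2 := emp_m2 X in
  let m3 := emp_m3 X in
  ((exists q, p q != Q%:R^-1) ->
   forall alpha_hat beta_hat : nat -> {RV P >-> R},
     (forall n w,
        let den := (m1 n w ^+ 2 - m2 n w) *
                   (2 * s2 ^+ 3 - 3 * s3 * s2 + s3) in
        den != 0 ->
        beta_hat n w =
          ((s3 - s2 * s3) * m1 n w ^+ 3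
           + (s2 ^+ 3 - s3) * m2 n w * m1 n w
           + (s3 * s2 - s2 ^+ 3) * m3 n w) / den /\
        alpha_hat n w = (m1 n w + (s2 - 1) * beta_hat n w) / s2) ->
     {ae P, forall w,
        (alpha_hat n w, beta_hat n w) @[n --> \oo] --> (alpha, beta)} /\
     convergence_rate_at_least P
       (fun n w => (alpha_hat n w, beta_hat n w)) (alpha, beta)
       (fun n => 1 / Num.sqrt n%:R))
  /\
  ((forall q, p q = Q%:R^-1) ->
   let beta_hat := fun (n : nat) (w : T) =>
     m1 n w + cbrt ((m1 n w ^+ 3 - m3 n w) / (Q%:R - 1)) in
   let alpha_hat := fun (n : nat) (w : T) =>
     Q%:R * m1 n w + (1 - Q%:R) * beta_hat n w in
   {ae P, forall w,
      (alpha_hat n w, beta_hat n w) @[n --> \oo] --> (alpha, beta)} /\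
   convergence_rate_at_least P
     (fun n w => (alpha_hat n w, beta_hat n w)) (alpha, beta)
     (fun n => 1 / n%:R)).
Proof.
move=> s2 s3 m1 m2 m3; split=> [hne alpha_hat beta_hat hest|heq].
  exact: (unequal_proportions_rate hQ hp hp1 hbeta hab hmodel hne hest).
exact: (equal_proportions_rate hQ hp1 hab hmodel heq).
Qed.
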